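(* Let $G$ be a non-nilpotent meta-$\mathfrak{Nil}$-Hamiltonian group which is polycyclic-by-finite. Then $G'$ is finite, $G$ is finite-by-polycyclic (i.e. has a finite normal subgroup with polycyclic quotient), and $\mathrm{Fit}(G)$ is nilpotent-by-finite.
   Context: A group $G$ is meta-$\mathfrak{Nil}$-Hamiltonian if every non-nilpotent subgroup of $G$ is normal in $G$. Polycyclic-by-finite means having a polycyclic normal subgroup of finite index. $\mathrm{Fit}(G)$ is the Fitting subgroup of $G$ (generated by all nilpotent normal subgroups). *)

(* Defs.v *)
From Stdlib Require Import List.

Record Grp := {
  carrier :> Type;
  gmul : carrier -> carrier -> carrier;
  gone : carrier;
  ginv : carrier -> carrier;
  gmulA : forall x y z, gmul x (gmul y z) = gmul (gmul x y) z;
  gmul1 : forall x, gmul gone x = x;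
  gmulV : forall x, gmul (ginv x) x = gone
}.

Section GroupNotions.
Variable G : Grp.

Definition gset := G -> Prop.

Definition whole : gset := fun _ => True.
Definition trivial : gset := fun x => x = gone G.
Definition subset (A B : gset) : Prop := forall x, A x -> B x.

Definition subgroup (H : gset) : Prop :=
  H (gone G) /\ (forall x y, H x -> H y -> H (gmul G x y)) /\
  (forall x, H x -> H (ginv G x)).

Definition normal_in (H K : gset) : Prop :=
  subgroup H /\ subgroup K /\ subset H K /\
  (forall k h, K k -> H h -> H (gmul G (ginv G k) (gmul G h k))).

Definition gen (S : gset) : gset :=
  fun x => forall H, subgroup H -> subset S H -> H x.

Definition comm (x y : G) : G :=
  gmul G (ginv G x) (gmul G (ginv G y) (gmul G x y)).

Definition commg (A B : gset) : gset :=
  gen (fun z => exists a b, A a /\ B b /\ z = comm a b).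

Definition derived : gset := commg whole whole.

Fixpoint lcs (H : gset) (n : nat) : gset :=
  match n with
  | O => H
  | S m => commg (lcs H m) H
  end.

Definition nilpotent (H : gset) : Prop :=
  subgroup H /\ exists n, subset (lcs H n) trivial.

Definition finite_set (A : gset) : Prop :=
  exists l : list G, forall x, A x -> In x l.

Definition finite_index (H K : gset) : Prop :=
  exists l : list G, (forall r, In r l -> K r) /\
    forall x, K x -> exists r, In r l /\ H (gmul G (ginv G r) x).

(* a series N = S_0 <= S_1 <= ... <= S_n = H, each S_i normal in S_{i+1}
   with S_{i+1}/S_i cyclic (S_{i+1} generated by S_i and one element).
   polycyclic_over N H says exactly that H/N is polycyclic. *)
Definition polycyclic_over (N H : gset) : Prop :=
  exists (n : nat) (S : nat -> gset),
    (forall x, S O x <-> N x) /\ (forall x, S n x <-> H x) /\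
    forall i, i < n ->
      normal_in (S i) (S (Datatypes.S i)) /\
      exists g, forall x, S (Datatypes.S i) x <-> gen (fun y => S i y \/ y = g) x.

Definition polycyclic (H : gset) : Prop := polycyclic_over trivial H.

Definition polycyclic_by_finite : Prop :=
  exists P, normal_in P whole /\ polycyclic P /\ finite_index P whole.

Definition finite_by_polycyclic : Prop :=
  exists N, normal_in N whole /\ finite_set N /\ polycyclic_over N whole.

Definition Fit : gset :=
  gen (fun x => exists N, normal_in N whole /\ nilpotent N /\ N x).

Definition nilpotent_by_finite (H : gset) : Prop :=
  exists M, normal_in M H /\ nilpotent M /\ finite_index M H.

Definition meta_Nil_Hamiltonian : Prop :=
  forall H, subgroup H -> ~ nilpotent H -> normal_in H whole.

End GroupNotions.

(* Main.v *)
(* The heart of the matter is that G' is finite.  Polycyclic-by-finite groups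
   satisfy the maximal condition, so one may assume that every proper quotient
   of G is nilpotent or has finite derived subgroup.

   Suppose G has no nontrivial finite normal subgroup, and let A be a
   torsion-free abelian normal subgroup.  An element x acting non-nilpotently
   on A makes every <x>A^n non-nilpotent, hence normal, which forces
   [A,x,x] <= A^n for all n, hence [A,x,x] = 1, a contradiction.  So elements
   act unipotently, which yields a nontrivial center Z; if G'/(G' n Z) is
   finite, the transfer G' -> G' n Z shows G' <= Z, so G is nilpotent.

   Otherwise G is nilpotent modulo a finite normal subgroup F.  A suitable
   quotient E of G/F has class two with E' torsion-free.  For q = 1 modulo the
   exponent of G/C_G(F), any subgroup containing F and all q-th powers is
   non-nilpotent, hence normal; normality of E^q<x> with q also prime to the
   roots of c = [x,y] in Z(E) forces c to be a q-th power in Z(E), which is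
   absurd. *)

From Stdlib Require Import List Arith ZArith Lia Permutation.
From Stdlib Require Import Classical ClassicalEpsilon FunctionalExtensionality.
From Stdlib Require Import PropExtensionality ProofIrrelevance.
Require Import Defs.
Import ListNotations.

Section FiniteDerivedSubgroup.

#[local] Arguments gmul {_} _ _.
#[local] Arguments gone {_}.
#[local] Arguments ginv {_} _.
#[local] Arguments whole {_} _.
#[local] Arguments trivial {_} _.
#[local] Arguments subset {_} _ _.
#[local] Arguments subgroup {_} _.
#[local] Arguments normal_in {_} _ _.
#[local] Arguments gen {_} _ _.
#[local] Arguments comm {_} _ _.
#[local] Arguments commg {_} _ _ _.
#[local] Arguments derived {_} _.
#[local] Arguments lcs {_} _ _ _.
#[local] Arguments nilpotent {_} _.
#[local] Arguments finite_set {_} _.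
#[local] Arguments finite_index {_} _ _.
#[local] Arguments polycyclic_over {_} _ _.

Notation "x ** y" := (gmul x y) (at level 40, left associativity).
Notation "x ^-1" := (ginv x) (at level 3, format "x ^-1").

(** Being polycyclic-by-finite enters only through two consequences that pass easily to quotients:
    every subgroup is finitely generated, and there is a normal series with abelian or finite
    factors. The first supplies maximal elements; the second supplies a nontrivial normal subgroup
    that is abelian or finite. The hypothesis on subgroups survives in quotients because the
    preimage of a non-nilpotent subgroup is non-nilpotent. The obstacle is that normality is
    available only for subgroups known to be non-nilpotent. Both constructions shrink a subgroup
    while keeping the cause of its non-nilpotency: A^n keeps the action of x because A is
    torsion-free, and q-th powers keep the action of G on F. Divisibility by too large a number is
    then refuted because the roots of powers of a fixed element form a finitely generated group.
    Once G' is finite, the rest is short: G/G' is finitely generated abelian, and the centralizer of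
    G' has finite index and class at most two. *)

Definition conj {G : Grp} (x g : G) : G := g^-1 ** (x ** g).

(** * Elementary identities *)

Lemma mulgA {G : Grp} (x y z : G) : x ** y ** z = x ** (y ** z).
Proof. symmetry; apply gmulA. Qed.

Lemma mulKg {G : Grp} (x y : G) : x^-1 ** (x ** y) = y.
Proof. now rewrite gmulA, gmulV, gmul1. Qed.

Lemma mulg_injl {G : Grp} (x y z : G) : x ** y = x ** z -> y = z.
Proof. intro E. now rewrite <- (mulKg x y), E, mulKg. Qed.

Lemma mulg1 {G : Grp} (x : G) : x ** gone = x.
Proof.
apply (mulg_injl (x^-1)). now rewrite gmulA, gmulV, gmul1.
Qed.

Lemma mulgV {G : Grp} (x : G) : x ** x^-1 = gone.
Proof. apply (mulg_injl (x^-1)). now rewrite mulKg, mulg1. Qed.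

Lemma mulVKg {G : Grp} (x y : G) : x ** (x^-1 ** y) = y.
Proof. now rewrite gmulA, mulgV, gmul1. Qed.

Lemma invg_uniq {G : Grp} (x y : G) : x ** y = gone -> y = x^-1.
Proof. intro E. now rewrite <- (mulKg x y), E, mulg1. Qed.

Lemma invgK {G : Grp} (x : G) : (x^-1)^-1 = x.
Proof. symmetry; apply invg_uniq, gmulV. Qed.

Lemma invgM {G : Grp} (x y : G) : (x ** y)^-1 = y^-1 ** x^-1.
Proof.
symmetry; apply invg_uniq. now rewrite mulgA, (gmulA _ y), mulgV, gmul1, mulgV.
Qed.

Lemma invg1 {G : Grp} : (gone : G)^-1 = gone.
Proof. symmetry; apply invg_uniq, gmul1. Qed.

Hint Rewrite @mulgA @mulKg @mulVKg @gmul1 @gmulV @mulg1 @mulgV @invgK @invgM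
  @invg1 : grp.

Ltac gsimp := unfold conj, comm; autorewrite with grp.
Ltac gsimp_in H := unfold conj, comm in H; autorewrite with grp in H.
Ltac grp := intros; gsimp; try reflexivity.

Lemma eqg_Vmul {G : Grp} (x y : G) : x^-1 ** y = gone -> x = y.
Proof. intro E. rewrite <- (mulg1 x), <- E. grp. Qed.

Lemma comm_eq1 {G : Grp} (x y : G) : comm x y = gone <-> x ** y = y ** x.
Proof.
split; intro E.
- apply (mulg_injl (y^-1)). apply (mulg_injl (x^-1)).
  rewrite mulKg, gmulV. exact E.
- unfold comm. rewrite E. grp.
Qed.

Lemma conj_eq {G : Grp} (x y : G) : x ** y = y ** x -> conj x y = x.
Proof. intro E. unfold conj. rewrite E. grp. Qed.

Lemma conj_comm {G : Grp} (x y : G) : conj x y = x ** comm x y.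
Proof. grp. Qed.

Lemma conjV {G : Grp} (x g : G) : conj x^-1 g = (conj x g)^-1.
Proof. grp. Qed.

Lemma conjM {G : Grp} (x y g : G) : conj (x ** y) g = conj x g ** conj y g.
Proof. grp. Qed.

Lemma conj_comp {G : Grp} (x g h : G) : conj (conj x g) h = conj x (g ** h).
Proof. grp. Qed.

Lemma conj_commg {G : Grp} (x y g : G) :
  conj (comm x y) g = comm (conj x g) (conj y g).
Proof. grp. Qed.

(** * Integer powers *)

Definition npow {G : Grp} (x : G) (n : nat) : G := Nat.iter n (gmul x) gone.

(** At most one of the two factors is nontrivial, so a single formula covers both signs. *)
Definition zpow {G : Grp} (x : G) (n : Z) : G :=
  npow x (Z.to_nat n) ** (npow x (Z.to_nat (- n)))^-1.

Lemma npowSr {G : Grp} (x : G) n : npow x (S n) = npow x n ** x.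
Proof.
induction n as [|n IH].
- unfold npow; simpl. grp.
- change (npow x (S (S n))) with (x ** npow x (S n)).
  rewrite IH at 1. rewrite gmulA. reflexivity.
Qed.

Lemma zpow0 {G : Grp} (x : G) : zpow x 0 = gone.
Proof. unfold zpow, npow; simpl. grp. Qed.

Lemma zpowSl {G : Grp} (x : G) n : zpow x (n + 1) = x ** zpow x n.
Proof.
unfold zpow. destruct (Z_le_gt_dec 0 n) as [H|H].
- replace (Z.to_nat (n + 1)) with (S (Z.to_nat n)) by lia.
  replace (Z.to_nat (- n)) with 0%nat by lia.
  replace (Z.to_nat (- (n + 1))) with 0%nat by lia.
  simpl. grp.
- replace (Z.to_nat (n + 1)) with 0%nat by lia.
  replace (Z.to_nat n) with 0%nat by lia.
  replace (Z.to_nat (- n)) with (S (Z.to_nat (- (n + 1)))) by lia.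
  rewrite npowSr. unfold npow at 1 3; simpl. grp.
Qed.

Lemma zpow1 {G : Grp} (x : G) : zpow x 1 = x.
Proof. change 1%Z with (0 + 1)%Z. rewrite zpowSl, zpow0. grp. Qed.

(** The downward step is phrased from n + 1 to n, so that both directions use the recurrence
    [zpowSl], once forwards and once by cancellation. *)
Lemma Z_ind_both (P : Z -> Prop) :
  P 0%Z -> (forall n, P n -> P (n + 1)%Z) -> (forall n, P (n + 1)%Z -> P n) ->
  forall n, P n.
Proof.
intros H0 HS HP. apply Z.peano_ind; [exact H0|exact HS|].
intros n Hn. apply HP. replace (Z.pred n + 1)%Z with n by lia. exact Hn.
Qed.

Lemma zpowD {G : Grp} (x : G) m n : zpow x (m + n) = zpow x m ** zpow x n.
Proof.
revert m. apply Z_ind_both.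
- rewrite zpow0. grp.
- intros m IH. replace (m + 1 + n)%Z with (m + n + 1)%Z by lia.
  rewrite !zpowSl, IH. grp.
- intros m IH. replace (m + 1 + n)%Z with (m + n + 1)%Z in IH by lia.
  rewrite !zpowSl, mulgA in IH. now apply mulg_injl in IH.
Qed.

Lemma zpowN {G : Grp} (x : G) n : zpow x (- n) = (zpow x n)^-1.
Proof.
apply invg_uniq. rewrite <- zpowD. replace (n + - n)%Z with 0%Z by lia.
apply zpow0.
Qed.

Lemma zpowM {G : Grp} (x : G) m n : zpow x (m * n) = zpow (zpow x m) n.
Proof.
revert n. apply Z_ind_both.
- now rewrite Z.mul_0_r, !zpow0.
- intros n IH. replace (m * (n + 1))%Z with (m + m * n)%Z by lia.
  now rewrite zpowD, zpowSl, IH.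
- intros n IH. replace (m * (n + 1))%Z with (m + m * n)%Z in IH by lia.
  rewrite zpowD, zpowSl in IH. now apply mulg_injl in IH.
Qed.

Lemma zpow1g {G : Grp} n : zpow (gone : G) n = gone.
Proof.
revert n. apply Z_ind_both.
- apply zpow0.
- intros n IH. rewrite zpowSl, IH. grp.
- intros n IH. rewrite zpowSl in IH. now rewrite gmul1 in IH.
Qed.

Definition is_hom {G Q : Grp} (f : G -> Q) : Prop :=
  forall x y, f (x ** y) = f x ** f y.

Lemma hom1 {G Q : Grp} (f : G -> Q) : is_hom f -> f gone = gone.
Proof.
intro Hf. apply (mulg_injl (f gone)). rewrite <- Hf. grp.
Qed.

Lemma homV {G Q : Grp} (f : G -> Q) x : is_hom f -> f x^-1 = (f x)^-1.
Proof.
intro Hf. apply invg_uniq. rewrite <- Hf, mulgV. now apply hom1.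
Qed.

Lemma hom_comm {G Q : Grp} (f : G -> Q) x y :
  is_hom f -> f (comm x y) = comm (f x) (f y).
Proof. intro Hf. unfold comm. now rewrite !Hf, !homV. Qed.

Lemma hom_conj {G Q : Grp} (f : G -> Q) x y :
  is_hom f -> f (conj x y) = conj (f x) (f y).
Proof. intro Hf. unfold conj. now rewrite !Hf, !homV. Qed.

Lemma hom_zpow {G Q : Grp} (f : G -> Q) x n :
  is_hom f -> f (zpow x n) = zpow (f x) n.
Proof.
intro Hf. revert n. apply Z_ind_both.
- rewrite !zpow0. now apply hom1.
- intros n IH. now rewrite !zpowSl, Hf, IH.
- intros n IH. rewrite !zpowSl, Hf in IH. now apply mulg_injl in IH.
Qed.

Lemma conj_zpow {G : Grp} (x g : G) n : conj (zpow x n) g = zpow (conj x g) n.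
Proof. apply (hom_zpow (fun x => conj x g)). intros a b. apply conjM. Qed.

Lemma zpow_commute {G : Grp} (x y : G) n :
  x ** y = y ** x -> zpow x n ** y = y ** zpow x n.
Proof.
intro E. assert (H : conj (zpow x n) y = zpow x n).
{ rewrite conj_zpow. now rewrite conj_eq. }
rewrite <- H at 2. grp.
Qed.

Lemma zpowMg {G : Grp} (x y : G) n :
  x ** y = y ** x -> zpow (x ** y) n = zpow x n ** zpow y n.
Proof.
intro E. revert n. apply Z_ind_both.
- rewrite !zpow0. grp.
- intros n IH. rewrite !zpowSl, IH.
  rewrite !mulgA. f_equal. rewrite <- !mulgA. f_equal.
  symmetry. now apply zpow_commute.
- intros n IH. rewrite !zpowSl in IH. apply (mulg_injl (x ** y)). rewrite IH.
  rewrite !mulgA. f_equal. rewrite <- !mulgA. f_equal.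
  now apply zpow_commute.
Qed.

Lemma zpowVg {G : Grp} (x : G) n : zpow x^-1 n = (zpow x n)^-1.
Proof.
rewrite <- zpowN. rewrite <- (zpow1 x) at 1. rewrite <- zpowN, <- zpowM.
reflexivity.
Qed.

(** * Subgroups *)

Lemma subgroup_one {G : Grp} (H : gset G) : subgroup H -> H gone.
Proof. now intros []. Qed.

Lemma subgroup_mul {G : Grp} (H : gset G) x y :
  subgroup H -> H x -> H y -> H (x ** y).
Proof. intros [_ [Hm _]]; auto. Qed.

Lemma subgroup_inv {G : Grp} (H : gset G) x : subgroup H -> H x -> H x^-1.
Proof. intros [_ [_ Hi]]; auto. Qed.

Lemma subgroup_comm {G : Grp} (H : gset G) x y :
  subgroup H -> H x -> H y -> H (comm x y).
Proof.
intros sH Hx Hy. unfold comm.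
repeat first [ assumption | apply subgroup_mul | apply subgroup_inv ].
Qed.

Lemma subgroup_zpow {G : Grp} (H : gset G) x n :
  subgroup H -> H x -> H (zpow x n).
Proof.
intros sH Hx. revert n. apply Z_ind_both.
- rewrite zpow0. now apply subgroup_one.
- intros n IH. rewrite zpowSl. now apply subgroup_mul.
- intros n IH. rewrite zpowSl in IH. rewrite <- (mulKg x (zpow x n)).
  apply subgroup_mul; auto. now apply subgroup_inv.
Qed.

Lemma subgroup_cancelr {G : Grp} (H : gset G) x y :
  subgroup H -> H y -> H (x ** y) -> H x.
Proof.
intros sH Hy Hxy. replace x with (x ** y ** y^-1) by grp.
apply subgroup_mul; auto. now apply subgroup_inv.
Qed.

Lemma subgroup_whole {G : Grp} : subgroup (whole : gset G).
Proof. repeat split. Qed.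

Lemma subgroup_trivial {G : Grp} : subgroup (trivial : gset G).
Proof.
unfold trivial. split; [reflexivity|split].
- intros x y -> ->. grp.
- intros x ->. grp.
Qed.

Lemma subgroup_inter {G : Grp} (H K : gset G) :
  subgroup H -> subgroup K -> subgroup (fun x => H x /\ K x).
Proof.
intros sH sK. split; [|split].
- split; now apply subgroup_one.
- intros x y [] []. split; now apply subgroup_mul.
- intros x []. split; now apply subgroup_inv.
Qed.

Lemma subgroup_gen {G : Grp} (A : gset G) : subgroup (gen A).
Proof.
split; [|split].
- intros H sH _. now apply subgroup_one.
- intros x y Hx Hy H sH AH. apply subgroup_mul; [exact sH|now apply Hx|now apply Hy].
- intros x Hx H sH AH. apply subgroup_inv; [exact sH|now apply Hx].
Qed.

Lemma gen_in {G : Grp} (A : gset G) x : A x -> gen A x.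
Proof. intros Ax H _ AH. auto. Qed.

Definition nsub {G : Grp} (N : gset G) : Prop := normal_in N whole.

Lemma nsub_intro {G : Grp} (N : gset G) :
  subgroup N -> (forall x g, N x -> N (conj x g)) -> nsub N.
Proof.
intros sN cN. split; [exact sN|]. split; [apply subgroup_whole|].
split; [now intros x _|]. intros g x _ Nx. now apply cN.
Qed.

Lemma nsub_subgroup {G : Grp} (N : gset G) : nsub N -> subgroup N.
Proof. now intros []. Qed.

Lemma nsub_conj {G : Grp} (N : gset G) x g : nsub N -> N x -> N (conj x g).
Proof. intros [_ [_ [_ cN]]] Nx. now apply cN. Qed.

Lemma nsub_comml {G : Grp} (N : gset G) x g : nsub N -> N x -> N (comm x g).
Proof.
intros nN Nx. replace (comm x g) with (x^-1 ** conj x g) by grp.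
apply subgroup_mul; [now apply nsub_subgroup| |now apply nsub_conj].
apply subgroup_inv; auto. now apply nsub_subgroup.
Qed.

Lemma nsub_commr {G : Grp} (N : gset G) x g : nsub N -> N x -> N (comm g x).
Proof.
intros nN Nx. replace (comm g x) with ((comm x g)^-1) by grp.
apply subgroup_inv; [now apply nsub_subgroup|]. now apply nsub_comml.
Qed.

Lemma nsub_swap {G : Grp} (N : gset G) x y : nsub N -> N (x ** y) -> N (y ** x).
Proof.
intros nN Nxy. replace (y ** x) with (conj (x ** y) x) by grp.
now apply nsub_conj.
Qed.

Lemma nsub_inter {G : Grp} (M N : gset G) :
  nsub M -> nsub N -> nsub (fun x => M x /\ N x).
Proof.
intros nM nN. apply nsub_intro.
- apply subgroup_inter; now apply nsub_subgroup.
- intros x g [Mx Nx]. split; now apply nsub_conj.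
Qed.

Lemma nsub_trivial {G : Grp} : nsub (trivial : gset G).
Proof.
apply nsub_intro; [apply subgroup_trivial|]. intros x g ->. unfold trivial. grp.
Qed.

Lemma nsub_whole {G : Grp} : nsub (whole : gset G).
Proof. apply nsub_intro; [apply subgroup_whole|]. now intros. Qed.

Lemma commg_in {G : Grp} (A B : gset G) a b : A a -> B b -> commg A B (comm a b).
Proof. intros Aa Bb. apply gen_in. now exists a, b. Qed.

Lemma commg_sub {G : Grp} (A B K : gset G) :
  subgroup K -> (forall a b, A a -> B b -> K (comm a b)) -> subset (commg A B) K.
Proof.
intros sK H x Hx. apply Hx; [exact sK|]. intros z (a & b & Aa & Bb & ->). auto.
Qed.

Lemma subgroup_commg {G : Grp} (A B : gset G) : subgroup (commg A B).
Proof. apply subgroup_gen. Qed.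

Lemma nsub_commg {G : Grp} (A B : gset G) : nsub A -> nsub B -> nsub (commg A B).
Proof.
intros nA nB. apply nsub_intro; [apply subgroup_commg|].
intros x g Hx. revert x Hx.
apply (commg_sub A B (fun x => commg A B (conj x g))).
- pose proof (subgroup_commg A B) as sC. split; [|split].
  + replace (conj gone g) with (gone : G) by grp. now apply subgroup_one.
  + intros x y Hx Hy. rewrite conjM. now apply subgroup_mul.
  + intros x Hx. rewrite conjV. now apply subgroup_inv.
- intros a b Aa Bb. rewrite conj_commg. apply commg_in; now apply nsub_conj.
Qed.

Lemma nsub_derived {G : Grp} : nsub (derived : gset G).
Proof. apply nsub_commg; apply nsub_whole. Qed.

Definition centr {G : Grp} (A : gset G) : gset G :=
  fun x => forall a, A a -> x ** a = a ** x.

Lemma subgroup_centr {G : Grp} (A : gset G) : subgroup (centr A).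
Proof.
split; [|split].
- intros a _. grp.
- intros x y Hx Hy a Aa. now rewrite mulgA, Hy, gmulA, Hx, mulgA.
- intros x Hx a Aa. apply (mulg_injl x).
  rewrite mulVKg, gmulA, Hx; auto. grp.
Qed.

Lemma nsub_centr {G : Grp} (A : gset G) : nsub A -> nsub (centr A).
Proof.
intro nA. apply nsub_intro; [apply subgroup_centr|].
intros x g Hx a Aa. assert (E := Hx _ (nsub_conj A a g^-1 nA Aa)).
gsimp_in E. apply (f_equal (fun u => conj u g)) in E. gsimp_in E.
gsimp. exact E.
Qed.

Definition center {G : Grp} : gset G := centr whole.

Lemma nsub_center {G : Grp} : nsub (center : gset G).
Proof. apply nsub_centr, nsub_whole. Qed.

(** * Finiteness *)

(** The labels in [lU] need not be related to [K]. For each label that occurs on [K] one member of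
    [K] carrying it is kept; this moves coset representatives into a prescribed subgroup. *)
Lemma finite_reps {T U : Type} (R : T -> U -> Prop) (lU : list U) (K : T -> Prop) :
  (forall x, K x -> exists u, In u lU /\ R x u) ->
  exists l : list T, (forall r, In r l -> K r) /\
    forall x, K x -> exists r u, In r l /\ R x u /\ R r u.
Proof.
revert K. induction lU as [|u lU IH]; intros K HK.
- exists []. split; [now intros r []|]. intros x Kx. now destruct (HK x Kx) as (? & [] & _).
- destruct (IH (fun x => K x /\ ~ R x u)) as (l & Hl & Hcov).
  { intros x [Kx nR]. destruct (HK x Kx) as (v & [<-|Hv] & Rv); [easy|].
    now exists v. }
  destruct (classic (exists x, K x /\ R x u)) as [(x0 & Kx0 & Rx0)|no].
  + exists (x0 :: l). split.
    * intros r [<-|Hr]; [exact Kx0|]. now apply Hl.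
    * intros x Kx. destruct (classic (R x u)) as [Rx|nR].
      -- exists x0, u. split; [now left|]. now split.
      -- destruct (Hcov x (Logic.conj Kx nR)) as (r & v & Hr & H). exists r, v.
         split; [now right|exact H].
  + exists l. split; [intros r Hr; now apply Hl|].
    intros x Kx. apply Hcov. split; [exact Kx|]. intro Rx. apply no. now exists x.
Qed.

(** [A] meets only finitely many left cosets of [K]. In contrast to [finite_index], representatives
    may lie outside [A], and the notion is meaningful when [K] is not contained in [A]. *)
Definition finmod {G : Grp} (A K : gset G) : Prop :=
  exists l : list G, forall x, A x -> exists r, In r l /\ K (r^-1 ** x).

Lemma finmod_index {G : Grp} (A K : gset G) :
  subgroup K -> finmod A K ->
  exists l : list G, (forall r, In r l -> A r) /\
    forall x, A x -> exists r, In r l /\ K (r^-1 ** x).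
Proof.
intros sK [l0 H]. destruct (finite_reps (fun x u => K (u^-1 ** x)) l0 A H) as (l & Hl & Hc).
exists l. split; [exact Hl|]. intros x Ax. destruct (Hc x Ax) as (r & u & Hr & Hx & Hu).
exists r. split; [exact Hr|].
replace (r^-1 ** x) with ((u^-1 ** r)^-1 ** (u^-1 ** x)) by grp.
apply subgroup_mul; auto. now apply subgroup_inv.
Qed.

Lemma finmod_finite {G : Grp} (A K : gset G) :
  finite_set K -> finmod A K -> finite_set A.
Proof.
intros [lK HK] [l Hl].
exists (map (fun p => fst p ** snd p) (list_prod l lK)).
intros x Ax. destruct (Hl x Ax) as (r & Hr & Kx).
apply in_map_iff. exists (r, r^-1 ** x). split; [simpl; grp|].
apply in_prod; auto.
Qed.

Lemma finmod_inj_finite {G : Grp} (A K : gset G) :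
  subgroup K -> (forall x y, A x -> A y -> K (x^-1 ** y) -> x = y) ->
  finmod A K -> finite_set A.
Proof.
intros sK inj fA. destruct (finmod_index A K sK fA) as (l & Hl & Hc).
exists l. intros x Ax. destruct (Hc x Ax) as (r & Hr & Kx).
now rewrite <- (inj r x (Hl r Hr) Ax Kx).
Qed.

(** A label either stops occurring, and is dropped after passing to a tail of the sequence, or
    occurs arbitrarily late, hence twice. *)
Lemma pigeonhole {T U : Type} (R : T -> U -> Prop) (l : list U) (s : nat -> T) :
  (forall n, exists u, In u l /\ R (s n) u) ->
  exists i j u, (i < j)%nat /\ R (s i) u /\ R (s j) u.
Proof.
revert s. induction l as [|u l IH]; intros s H.
- destruct (H 0%nat) as (? & [] & _).
- destruct (classic (exists n0, forall n, (n0 <= n)%nat -> ~ R (s n) u)) as [[n0 H0]|no].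
  + destruct (IH (fun n => s (n0 + n)%nat)) as (i & j & v & ij & Hi & Hj).
    * intro n. destruct (H (n0 + n)%nat) as (v & [<-|Hv] & Rv).
      -- exfalso. apply (H0 (n0 + n)%nat); [lia|exact Rv].
      -- now exists v.
    * exists (n0 + i)%nat, (n0 + j)%nat, v. split; [lia|]. now split.
  + assert (inf : forall n0, exists n, (n0 <= n)%nat /\ R (s n) u).
    { intro n0. apply NNPP. intro nn. apply no. exists n0. intros n Hn Rn.
      apply nn. now exists n. }
    destruct (inf 0%nat) as (i & _ & Ri). destruct (inf (S i)) as (j & ij & Rj).
    exists i, j, u. split; [lia|]. now split.
Qed.

Lemma finmod_zpow {G : Grp} (A K : gset G) x :
  subgroup A -> subgroup K -> finmod A K -> A x ->
  exists m, (0 < m)%Z /\ K (zpow x m).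
Proof.
intros sA sK [l Hl] Ax.
destruct (pigeonhole (fun y u => K (u^-1 ** y)) l (fun n => zpow x (Z.of_nat n)))
  as (i & j & u & ij & Hi & Hj).
{ intro n. apply Hl. now apply subgroup_zpow. }
exists (- Z.of_nat i + Z.of_nat j)%Z. split; [lia|].
rewrite zpowD, zpowN.
replace (_ ** _) with ((u^-1 ** zpow x (Z.of_nat i))^-1 ** (u^-1 ** zpow x (Z.of_nat j)))
  by grp.
apply subgroup_mul; auto. now apply subgroup_inv.
Qed.

Lemma finite_index_trans {G : Grp} (A B C : gset G) :
  subgroup C -> subset B C -> finite_index A B -> finite_index B C -> finite_index A C.
Proof.
intros sC BC [la [Hla Ha]] [lb [Hlb Hb]].
exists (map (fun p => fst p ** snd p) (list_prod lb la)). split.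
- intros r Hr. apply in_map_iff in Hr. destruct Hr as ([b a] & <- & Hp).
  apply in_prod_iff in Hp. apply subgroup_mul; auto.
  + now apply Hlb.
  + now apply BC, Hla.
- intros x Cx. destruct (Hb x Cx) as (b & Hib & Bx).
  destruct (Ha _ Bx) as (a & Hia & Ax). exists (b ** a). split.
  + apply in_map_iff. exists (b, a). split; [reflexivity|]. now apply in_prod.
  + now rewrite invgM, mulgA.
Qed.

(** Conjugation acts on the finite set [F], so the stabilizer of each element has finite index; the
    elements are treated one after the other. *)
Lemma centr_finite_index {G : Grp} (F K : gset G) :
  nsub F -> finite_set F -> subgroup K -> finite_index (fun x => K x /\ centr F x) K.
Proof.
intros nF [lF HF] sK.
assert (main : forall l : list G, (forall y, In y l -> F y) ->
  finite_index (fun x => K x /\ centr (fun y => In y l) x) K).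
{ induction l as [|f l IH]; intro Hl.
  - exists [gone]. split.
    + intros r [<-|[]]. now apply subgroup_one.
    + intros x Kx. exists gone. split; [now left|].
      rewrite invg1, gmul1. split; [exact Kx|now intros a []].
  - assert (IH' := IH (fun y Hy => Hl y (or_intror Hy))).
    refine (finite_index_trans _ _ _ sK _ _ IH'); [now intros x []|].
    set (C := fun x => K x /\ centr (fun y => In y l) x).
    assert (sC : subgroup C) by (apply subgroup_inter; [exact sK|apply subgroup_centr]).
    (* The label of x is x f x^-1: two elements r and x share it exactly when r^-1 x centralizes f,
       which matches left cosets. *)
    destruct (finite_reps (fun x u => conj f x^-1 = u) lF C) as (lr & Hlr & Hc).
    { intros x _. exists (conj f x^-1). split; [|reflexivity].
      apply HF. apply nsub_conj; [exact nF|]. apply Hl. now left. }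
    exists lr. split; [exact Hlr|]. intros x Cx.
    destruct (Hc x Cx) as (r & u & Hr & Ex & Er). exists r. split; [exact Hr|].
    assert (Crx : C (r^-1 ** x)).
    { apply subgroup_mul; auto. apply subgroup_inv; auto. }
    split; [apply Crx|]. intros a [<-|Ha]; [|now apply Crx].
    assert (E : conj f x^-1 = conj f r^-1) by congruence.
    gsimp_in E. apply (f_equal (fun u => r^-1 ** u ** x)) in E. gsimp_in E.
    gsimp. exact E. }
(* [lF] may contain elements outside [F], whereas [main] needs a list inside [F]. *)
destruct (finite_reps (fun x u => x = u) lF F) as (l & Hl & Hc).
{ intros x Fx. exists x. split; [now apply HF|reflexivity]. }
destruct (main l Hl) as (lr & Hlr & Hcov). exists lr. split; [exact Hlr|].
intros x Kx. destruct (Hcov x Kx) as (r & Hr & Kr & Cr). exists r.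
split; [exact Hr|]. split; [exact Kr|]. intros a Fa.
destruct (Hc a Fa) as (b & u & Hb & -> & ->). now apply Cr.
Qed.

(** * The maximal condition on subgroups *)

(** Every subgroup contained in [S] is finitely generated. *)
Definition noetherian_in {G : Grp} (S : gset G) : Prop :=
  forall H, subgroup H -> subset H S ->
  exists l : list G, (forall y, In y l -> H y) /\
    forall K, subgroup K -> (forall y, In y l -> K y) -> subset H K.

Definition noetherian (G : Grp) : Prop := noetherian_in (whole : gset G).

(** Without a maximal member, choice builds a strictly ascending chain. Its union is finitely
    generated, so it already equals some term of the chain. *)
Lemma maximal_subgroup {G : Grp} (F : gset G -> Prop) (H0 : gset G) :
  noetherian G -> (forall H, F H -> subgroup H) -> F H0 ->
  exists H, F H /\ subset H0 H /\ forall K, F K -> subset H K -> subset K H.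
Proof.
intros nG sF FH0. apply NNPP. intro no.
assert (next : forall H : {H | F H /\ subset H0 H}, exists K : {H | F H /\ subset H0 H},
  subset (proj1_sig H) (proj1_sig K) /\ ~ subset (proj1_sig K) (proj1_sig H)).
{ intros [H [FH HH]]. apply NNPP. intro nn. apply no. exists H. split; [exact FH|].
  split; [exact HH|]. intros K FK HK. apply NNPP. intro nKH. apply nn.
  assert (HK0 : subset H0 K) by (intros x Hx; apply HK, HH, Hx).
  exists (exist _ K (Logic.conj FK HK0)). now split. }
set (f := fun H => proj1_sig (constructive_indefinite_description _ (next H))).
assert (fP : forall H, subset (proj1_sig H) (proj1_sig (f H)) /\
  ~ subset (proj1_sig (f H)) (proj1_sig H)).
{ intro H. unfold f. now destruct (constructive_indefinite_description _ _). }
assert (HH0 : F H0 /\ subset H0 H0) by now split.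
set (c := fun n => Nat.iter n f (exist _ H0 HH0)).
assert (mono : forall m n, (m <= n)%nat -> subset (proj1_sig (c m)) (proj1_sig (c n))).
{ intros m n mn. induction mn as [|n mn IH]; [now intros x|].
  intros x Hx. apply (proj1 (fP (c n))). now apply IH. }
assert (sc : forall n, subgroup (proj1_sig (c n))).
{ intro n. apply sF. now destruct (c n) as [H []]. }
destruct (nG (fun x => exists n, proj1_sig (c n) x)) as (l & Hl & gen_l).
{ split; [|split].
  - exists 0%nat. now apply subgroup_one.
  - intros x y [m Hm] [n Hn]. exists (m + n)%nat. apply subgroup_mul; auto.
    + apply (mono m); [lia|exact Hm].
    + apply (mono n); [lia|exact Hn].
  - intros x [m Hm]. exists m. now apply subgroup_inv. }
{ now intros x _. }
assert (bound : exists n, forall y, In y l -> proj1_sig (c n) y).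
{ clear gen_l. induction l as [|y l IH].
  - exists 0%nat. now intros y [].
  - destruct IH as [n Hn]; [intros z Hz; apply Hl; now right|].
    destruct (Hl y (or_introl eq_refl)) as [m Hm]. exists (m + n)%nat.
    intros z [<-|Hz].
    + apply (mono m); [lia|exact Hm].
    + apply (mono n); [lia|]. now apply Hn. }
destruct bound as [n Hn]. apply (proj2 (fP (c n))).
intros x Hx. apply (gen_l _ (sc n) Hn). now exists (S n).
Qed.

Lemma Z_subgroup_principal (P : Z -> Prop) :
  P 0%Z -> (forall i j, P i -> P j -> P (i - j)%Z) ->
  exists d, P d /\ forall j, P j -> exists m, j = (d * m)%Z.
Proof.
intros P0 Pm.
assert (PN : forall i, P i -> P (- i)%Z).
{ intros i Pi. replace (- i)%Z with (0 - i)%Z by lia. auto. }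
assert (PM : forall i m, P i -> P (i * m)%Z).
{ intros i m Pi. revert m. apply Z_ind_both.
  - now rewrite Z.mul_0_r.
  - intros n Hn. replace (i * (n + 1))%Z with (i * n - - i)%Z by lia. auto.
  - intros n Hn. replace (i * n)%Z with (i * (n + 1) - i)%Z by lia. auto. }
destruct (classic (exists n : nat, (0 < n)%nat /\ P (Z.of_nat n))) as [ex|no].
- assert (least : forall n : nat, (0 < n)%nat -> P (Z.of_nat n) ->
    exists d : nat, (0 < d)%nat /\ P (Z.of_nat d) /\
      forall r : nat, (0 < r < d)%nat -> ~ P (Z.of_nat r)).
  { intro n. induction n as [n IH] using lt_wf_ind. intros n0 Pn.
    destruct (classic (exists r : nat, (0 < r < n)%nat /\ P (Z.of_nat r))) as [(r & rn & Pr)|no].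
    - apply (IH r); auto; lia.
    - exists n. split; [exact n0|]. split; [exact Pn|].
      intros r rn Pr. apply no. now exists r. }
  destruct ex as (n & n0 & Pn). destruct (least n n0 Pn) as (d & d0 & Pd & Hd).
  exists (Z.of_nat d). split; [exact Pd|]. intros j Pj.
  exists (j / Z.of_nat d)%Z.
  assert (Pr : P (j mod Z.of_nat d)%Z).
  { rewrite Z.mod_eq by lia. auto. }
  assert (B := Z.mod_pos_bound j (Z.of_nat d) ltac:(lia)).
  assert (E := Z.div_mod j (Z.of_nat d) ltac:(lia)).
  destruct (Z.eq_dec (j mod Z.of_nat d) 0) as [E0|n0']; [lia|].
  exfalso. apply (Hd (Z.to_nat (j mod Z.of_nat d))); [lia|].
  now rewrite Z2Nat.id by lia.
(* No positive element: the subgroup is zero. *)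
- exists 0%Z. split; [exact P0|]. intros j Pj. exists 0%Z.
  destruct (Z.eq_dec j 0) as [|nj]; [lia|]. exfalso. apply no.
  exists (Z.to_nat (Z.abs j)). split; [lia|]. rewrite Z2Nat.id by lia.
  destruct (Z.abs_eq_or_opp j) as [E|E]; rewrite E; auto.
Qed.

Lemma gen_cyclic_extension {G : Grp} (N H : gset G) (g : G) :
  normal_in N H -> (forall x, H x <-> gen (fun y => N y \/ y = g) x) ->
  forall x, H x -> exists s j, N s /\ x = s ** zpow g j.
Proof.
intros (sN & sH & NH & cN) HE x Hx.
assert (Hg : H g) by (apply HE, gen_in; now right).
assert (cN' : forall s k, N s -> H k -> N (k ** (s ** k^-1))).
{ intros s k Ns Hk. assert (Q := cN k^-1 s (subgroup_inv _ _ sH Hk) Ns).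
  now rewrite invgK in Q. }
apply HE in Hx.
apply (Hx (fun x => exists s j, N s /\ x = s ** zpow g j)).
- split; [|split].
  + exists gone, 0%Z. split; [now apply subgroup_one|]. rewrite zpow0. grp.
  + intros a b (s & i & Ns & ->) (t & j & Nt & ->).
    exists (s ** (zpow g i ** (t ** (zpow g i)^-1))), (i + j)%Z. split.
    * apply subgroup_mul; auto. apply cN'; [exact Nt|]. now apply subgroup_zpow.
    * rewrite zpowD. grp.
  + intros a (s & i & Ns & ->).
    exists ((zpow g i)^-1 ** (s^-1 ** zpow g i)), (- i)%Z. split.
    * apply cN; [now apply subgroup_zpow|now apply subgroup_inv].
    * rewrite zpowN. grp.
- intros y [Ny| ->].
  + exists y, 0%Z. split; [exact Ny|]. rewrite zpow0. grp.
  + exists gone, 1%Z. split; [now apply subgroup_one|]. rewrite zpow1. grp.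
Qed.

(** The congruence of (s y)^n and y^n modulo [N], obtained without forming H/N. *)
Lemma zpow_mod_normal {G : Grp} (N H : gset G) (s y : G) :
  normal_in N H -> N s -> H y ->
  forall n, exists t, N t /\ zpow (s ** y) n = t ** zpow y n.
Proof.
intros (sN & sH & NH & cN) Ns Hy. apply Z_ind_both.
- exists gone. split; [now apply subgroup_one|]. rewrite !zpow0. grp.
- intros n (t & Nt & E). exists (s ** (y ** (t ** y^-1))). split.
  + apply subgroup_mul; auto.
    assert (Q := cN y^-1 t (subgroup_inv _ _ sH Hy) Nt). now rewrite invgK in Q.
  + rewrite !zpowSl, E. grp.
- intros n (t & Nt & E). exists (y^-1 ** (s^-1 ** t ** y)). split.
  + apply cN; [exact Hy|]. apply subgroup_mul; auto. now apply subgroup_inv.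
  + rewrite !zpowSl in E. apply (mulg_injl (s ** y)). rewrite E. grp.
Qed.

(** For L in H, the exponents j for which L meets the coset N g^j form a subgroup dZ of the
    integers. One element s0 g^d of L, together with generators of the intersection of L and N,
    generates L. *)
Lemma noetherian_cyclic_extension {G : Grp} (N H : gset G) (g : G) :
  normal_in N H -> (forall x, H x <-> gen (fun y => N y \/ y = g) x) ->
  noetherian_in N -> noetherian_in H.
Proof.
intros nNH HE noeN L sL LH. pose proof nNH as (sN & sH & NH & cN).
assert (Hg : H g) by (apply HE, gen_in; now right).
destruct (Z_subgroup_principal (fun j => exists s, N s /\ L (s ** zpow g j)))
  as (d & (s0 & Ns0 & Ld) & Hd).
- exists gone. split; [now apply subgroup_one|]. rewrite zpow0, gmul1.
  now apply subgroup_one.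
- intros i j (s & Ns & Ls) (t & Nt & Lt).
  exists (s ** (zpow g (i - j) ** (t^-1 ** (zpow g (i - j))^-1))). split.
  + apply subgroup_mul; auto.
    assert (Q := cN (zpow g (i - j))^-1 t^-1). rewrite invgK in Q. apply Q.
    * apply subgroup_inv; auto. now apply subgroup_zpow.
    * now apply subgroup_inv.
  + replace (_ ** zpow g (i - j)) with ((s ** zpow g i) ** (t ** zpow g j)^-1).
    * apply subgroup_mul; auto. now apply subgroup_inv.
    * unfold Z.sub. rewrite zpowD, zpowN. grp.
- destruct (noeN (fun x => L x /\ N x)) as (l & Hl & gen_l).
  + now apply subgroup_inter.
  + now intros x [].
  + exists (s0 ** zpow g d :: l). split.
    * intros y [<-|Hy]; [exact Ld|]. now apply Hl.
    * intros K sK Hy x Lx.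
      destruct (gen_cyclic_extension N H g nNH HE x (LH x Lx)) as (s & j & Ns & ->).
      destruct (Hd j) as [m ->]; [now exists s|].
      destruct (zpow_mod_normal N H s0 (zpow g d) nNH Ns0 (subgroup_zpow _ _ _ sH Hg) m)
        as (t & Nt & E).
      rewrite zpowM in Lx |- *.
      (* After the m-th power of s0 g^d is split off, the remaining factor s t^-1 lies in both L and
         N. *)
      assert (Em : s ** zpow (zpow g d) m = (s ** t^-1) ** zpow (s0 ** zpow g d) m).
      { rewrite E. grp. }
      rewrite Em in Lx |- *.
      assert (Kp : K (zpow (s0 ** zpow g d) m)).
      { apply subgroup_zpow; auto. apply Hy. now left. }
      apply subgroup_mul; auto.
      apply (gen_l K sK); [intros y Hy'; apply Hy; now right|]. split.
      -- apply (subgroup_cancelr L _ (zpow (s0 ** zpow g d) m)); auto.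
         now apply subgroup_zpow.
      -- apply subgroup_mul; auto. now apply subgroup_inv.
Qed.

Lemma noetherian_finite_index {G : Grp} (P : gset G) :
  subgroup P -> noetherian_in P -> finite_index P whole -> noetherian G.
Proof.
intros sP nP [lP [_ HP]] H sH _.
destruct (nP (fun x => H x /\ P x)) as (l & Hl & gen_l).
{ now apply subgroup_inter. }
{ now intros x []. }
destruct (finmod_index H P sP) as (l' & Hl' & Hc).
{ exists lP. intros x _. now apply HP. }
exists (l' ++ l). split.
- intros y Hy. apply in_app_or in Hy. destruct Hy as [Hy|Hy]; auto. now apply Hl.
- intros K sK HK x Hx. destruct (Hc x Hx) as (r & Hr & Px).
  rewrite <- (mulVKg r x). apply subgroup_mul; auto.
  + apply HK, in_or_app. now left.
  + apply (gen_l K sK).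
    * intros y Hy. apply HK, in_or_app. now right.
    * split; [|exact Px]. apply subgroup_mul; auto. apply subgroup_inv; auto.
Qed.

Lemma noetherian_polycyclic_by_finite (G : Grp) : polycyclic_by_finite G -> noetherian G.
Proof.
intros (P & nP & (n & S & S0 & Sn & step) & fP).
assert (main : forall i, (i <= n)%nat -> noetherian_in (S i)).
{ induction i as [|i IH]; intro Hi.
  - intros H sH HS. exists []. split; [now intros y []|].
    intros K sK _ x Hx. apply HS, S0 in Hx. red in Hx. subst x. now apply subgroup_one.
  - destruct (step i Hi) as (nS & g & Hg).
    apply (noetherian_cyclic_extension (S i) _ g); auto. apply IH; lia. }
apply (noetherian_finite_index P); [now apply nsub_subgroup| |exact fP].
intros H sH HP. apply (main n); [lia|exact sH|]. intros x Hx. apply Sn. auto.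
Qed.

(** * Normal series with abelian or finite factors *)

(** All terms are normal in the whole group, unlike those of a polycyclic series, so the last
    nontrivial term is a normal subgroup of the group itself. *)
Inductive solvable_by_finite_series {G : Grp} : gset G -> Prop :=
| sf_trivial N : nsub N -> subset N trivial -> solvable_by_finite_series N
| sf_abelian N N' : nsub N -> solvable_by_finite_series N' ->
    (forall a b, N a -> N b -> N' (comm a b)) -> solvable_by_finite_series N
| sf_finite N N' : nsub N -> solvable_by_finite_series N' -> finmod N N' ->
    solvable_by_finite_series N.

(** The terms [S i] are normal only in their successors, so the derived series of [P] is used
    instead. If D lies in [S (i+1)], then [D,D] lies in [S i] because the factor is cyclic. *)
Lemma sf_polycyclic_by_finite (G : Grp) :
  polycyclic_by_finite G -> solvable_by_finite_series (whole : gset G).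
Proof.
intros (P & nP & (n & S & S0 & Sn & step) & (l & _ & fP)).
assert (main : forall i, (i <= n)%nat -> forall D, nsub D -> subset D (S i) ->
  solvable_by_finite_series D).
{ induction i as [|i IH]; intros Hi D nD DS.
  - apply sf_trivial; [exact nD|]. intros x Dx. now apply S0, DS.
  - destruct (step i Hi) as (nS & g & Hg).
    apply (sf_abelian D (commg D D)); [exact nD| |].
    + apply IH; [lia|now apply nsub_commg|].
      apply commg_sub; [apply nS|]. intros a b Da Db.
      destruct (gen_cyclic_extension _ _ g nS Hg a (DS a Da)) as (s & j & Ns & ->).
      destruct (gen_cyclic_extension _ _ g nS Hg b (DS b Db)) as (t & k & Nt & ->).
      destruct nS as (sN & sH & NH & cN).
      assert (Hgg : forall j, S (Datatypes.S i) (zpow g j)).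
      { intro m. apply subgroup_zpow; auto. apply Hg, gen_in. now right. }
      (* [s g^j, t g^k] is a product of conjugates of s and t, because the powers of g commute *)
      assert (E : comm (s ** zpow g j) (t ** zpow g k) =
        conj s^-1 (zpow g j) ** conj t^-1 (zpow g k ** zpow g j) **
        conj s (zpow g k ** zpow g j) ** conj t (zpow g k)).
      { assert (C : zpow g j ** zpow g k = zpow g k ** zpow g j)
          by (rewrite <- !zpowD; f_equal; lia).
        gsimp. do 5 f_equal. rewrite (gmulA _ (zpow g k) (zpow g j)), <- C. grp. }
      rewrite E.
      assert (Hkj : S (Datatypes.S i) (zpow g k ** zpow g j)) by (apply subgroup_mul; auto).
      apply subgroup_mul; [exact sN| |apply cN; auto].
      apply subgroup_mul; [exact sN| |apply cN; auto].
      apply subgroup_mul; [exact sN| |]; apply cN; auto; now apply subgroup_inv.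
    + intros a b Da Db. now apply commg_in. }
apply (sf_finite _ P); [apply nsub_whole| |].
- apply (main n); [lia|exact nP|]. intros x Px. now apply Sn.
- exists l. exact fP.
Qed.

Lemma sf_minimal_normal {G : Grp} (N : gset G) :
  solvable_by_finite_series N -> ~ subset N trivial ->
  exists D : gset G, nsub D /\ ~ subset D trivial /\
    ((forall a b, D a -> D b -> a ** b = b ** a) \/ finite_set D).
Proof.
induction 1 as [N nN tN|N N' nN sN' IH ab|N N' nN sN' IH fin]; intro ntN; [easy| |].
- destruct (classic (subset N' trivial)) as [t|nt]; [|now apply IH].
  exists N. split; [exact nN|]. split; [exact ntN|]. left.
  intros a b Na Nb. apply comm_eq1. now apply t, ab.
- destruct (classic (subset N' trivial)) as [t|nt]; [|now apply IH].
  exists N. split; [exact nN|]. split; [exact ntN|]. right.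
  apply (finmod_finite N N'); [|exact fin]. exists [gone]. intros x Nx.
  left. symmetry. now apply t.
Qed.

(** * Quotients *)

Section Quotient.
Variables (G : Grp) (N : gset G).
Hypothesis nN : nsub N.

Let coset (x : G) : G -> Prop := fun y => N (x^-1 ** y).

Let coset_eq x y : coset x = coset y <-> N (x^-1 ** y).
Proof.
pose proof (nsub_subgroup N nN) as sN. split.
- intro E. change (coset x y). rewrite E. unfold coset. rewrite gmulV.
  now apply subgroup_one.
- intro Nxy. apply functional_extensionality. intro z.
  apply propositional_extensionality. unfold coset. split; intro H.
  + replace (y^-1 ** z) with ((x^-1 ** y)^-1 ** (x^-1 ** z)) by grp.
    apply subgroup_mul; auto. now apply subgroup_inv.
  + replace (x^-1 ** z) with (x^-1 ** y ** (y^-1 ** z)) by grp.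
    now apply subgroup_mul.
Qed.

(** A coset is represented by its predicate, so by extensionality equal cosets are equal elements.
    The operations go through chosen representatives. *)
Let Q : Type := {C : G -> Prop | exists x, C = coset x}.

Let proj (x : G) : Q := exist _ (coset x) (ex_intro _ x eq_refl).

Let proj_eq x y : proj x = proj y <-> N (x^-1 ** y).
Proof.
rewrite <- coset_eq. split; intro E.
- apply (f_equal (@proj1_sig _ _)) in E. exact E.
- unfold proj. apply subset_eq_compat. exact E.
Qed.

Let rep (q : Q) : G :=
  proj1_sig (constructive_indefinite_description _ (proj2_sig q)).

Let proj_rep q : proj (rep q) = q.
Proof.
unfold rep. destruct (constructive_indefinite_description _ _) as [x Hx]. simpl.
destruct q as [C HC]. apply subset_eq_compat. now symmetry.
Qed.

Let qmul q r := proj (rep q ** rep r).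
Let qinv q := proj (rep q)^-1.

Let projM x y : proj (x ** y) = qmul (proj x) (proj y).
Proof.
pose proof (nsub_subgroup N nN) as sN.
assert (Hx : N (x^-1 ** rep (proj x))) by (apply proj_eq; now rewrite proj_rep).
assert (Hy : N (y^-1 ** rep (proj y))) by (apply proj_eq; now rewrite proj_rep).
apply proj_eq.
replace (_ ** _) with (conj (x^-1 ** rep (proj x)) y ** (y^-1 ** rep (proj y))) by grp.
apply subgroup_mul; auto. now apply nsub_conj.
Qed.

Let projV x : proj x^-1 = qinv (proj x).
Proof.
pose proof (nsub_subgroup N nN) as sN.
assert (Hx : N (x^-1 ** rep (proj x))) by (apply proj_eq; now rewrite proj_rep).
apply proj_eq. rewrite invgK. apply nsub_swap; [exact nN|].
replace (_ ** _) with ((x^-1 ** rep (proj x))^-1) by grp. now apply subgroup_inv.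
Qed.

Let qmulA q r s : qmul q (qmul r s) = qmul (qmul q r) s.
Proof.
rewrite <- (proj_rep q), <- (proj_rep r), <- (proj_rep s), <- !projM.
now rewrite mulgA.
Qed.

Let qmul1 q : qmul (proj gone) q = q.
Proof. rewrite <- (proj_rep q), <- projM. now rewrite gmul1. Qed.

Let qmulV q : qmul (qinv q) q = proj gone.
Proof. rewrite <- (proj_rep q), <- projV, <- projM. now rewrite gmulV. Qed.

Lemma quotient_exists :
  exists (Q : Grp) (f : G -> Q),
    is_hom f /\ (forall q, exists x, f x = q) /\ (forall x, f x = gone <-> N x).
Proof.
exists (Build_Grp Q qmul (proj gone) qinv qmulA qmul1 qmulV), proj.
split; [exact projM|]. split.
- intro q. exists (rep q). apply proj_rep.
- intro x. pose proof (nsub_subgroup N nN) as sN. simpl.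
  split; intro H.
  + symmetry in H. apply proj_eq in H. now rewrite invg1, gmul1 in H.
  + symmetry. apply proj_eq. now rewrite invg1, gmul1.
Qed.

End Quotient.

(** * Transport along surjective homomorphisms *)

Section Image.
Variables (G Q : Grp) (f : G -> Q).
Hypothesis (fM : is_hom f) (fsurj : forall q, exists x, f x = q).

Lemma subgroup_preim (K : gset Q) : subgroup K -> subgroup (fun x => K (f x)).
Proof.
intro sK. split; [|split].
- rewrite hom1 by exact fM. now apply subgroup_one.
- intros x y Hx Hy. rewrite fM. now apply subgroup_mul.
- intros x Hx. rewrite homV by exact fM. now apply subgroup_inv.
Qed.

Lemma nsub_preim (K : gset Q) : nsub K -> nsub (fun x => K (f x)).
Proof.
intro nK. apply nsub_intro; [now apply subgroup_preim, nsub_subgroup|].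
intros x g Hx. rewrite hom_conj by exact fM. now apply nsub_conj.
Qed.

Lemma subgroup_im (H : gset G) : subgroup H -> subgroup (fun q => exists x, H x /\ f x = q).
Proof.
intro sH. split; [|split].
- exists gone. split; [now apply subgroup_one|now apply hom1].
- intros _ _ (x & Hx & <-) (y & Hy & <-). exists (x ** y).
  split; [now apply subgroup_mul|apply fM].
- intros _ (x & Hx & <-). exists x^-1.
  split; [now apply subgroup_inv|now apply homV].
Qed.

Lemma nsub_im (H : gset G) : nsub H -> nsub (fun q => exists x, H x /\ f x = q).
Proof.
intro nH. apply nsub_intro; [now apply subgroup_im, nsub_subgroup|].
intros _ q (x & Hx & <-). destruct (fsurj q) as [g <-]. exists (conj x g).
split; [now apply nsub_conj|now apply hom_conj].
Qed.

Lemma commg_hom (A B : gset G) (A' B' : gset Q) :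
  (forall x, A x -> A' (f x)) -> (forall x, B x -> B' (f x)) ->
  forall x, commg A B x -> commg A' B' (f x).
Proof.
intros HA HB. apply commg_sub; [apply subgroup_preim, subgroup_commg|].
intros a b Aa Bb. rewrite hom_comm by exact fM. apply commg_in; auto.
Qed.

Lemma commg_lift (A B : gset G) (A' B' : gset Q) :
  (forall q, A' q -> exists x, A x /\ f x = q) ->
  (forall q, B' q -> exists x, B x /\ f x = q) ->
  forall q, commg A' B' q -> exists x, commg A B x /\ f x = q.
Proof.
intros HA HB. apply commg_sub; [apply subgroup_im, subgroup_commg|].
intros a b Aa Bb. destruct (HA a Aa) as (x & Ax & <-), (HB b Bb) as (y & By & <-).
exists (comm x y). split; [now apply commg_in|now apply hom_comm].
Qed.

Lemma lcs_hom (H : gset G) (K : gset Q) :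
  (forall x, H x -> K (f x)) -> forall n x, lcs H n x -> lcs K n (f x).
Proof.
intros HK n. induction n as [|n IH]; simpl; [exact HK|]. now apply commg_hom.
Qed.

Lemma lcs_lift (H : gset G) (K : gset Q) :
  (forall q, K q -> exists x, H x /\ f x = q) ->
  forall n q, lcs K n q -> exists x, lcs H n x /\ f x = q.
Proof.
intros HK n. induction n as [|n IH]; simpl; [exact HK|]. now apply commg_lift.
Qed.

Lemma derived_hom x : derived x -> derived (f x).
Proof. now apply commg_hom. Qed.

Lemma whole_lift (q : Q) : whole q -> exists x, whole x /\ f x = q.
Proof. intros _. destruct (fsurj q) as [x <-]. now exists x. Qed.

Lemma derived_lift q : derived q -> exists x, derived x /\ f x = q.
Proof. apply commg_lift; exact whole_lift. Qed.

(** The lower central series of the preimage maps onto that of [K]. This is why the hypothesis on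
    subgroups passes to quotients. *)
Lemma not_nilpotent_preim (K : gset Q) :
  subgroup K -> ~ nilpotent K -> ~ nilpotent (fun x => K (f x)).
Proof.
intros sK nK [_ [n Hn]]. apply nK. split; [exact sK|]. exists n. intros q Hq.
destruct (lcs_lift (fun x => K (f x)) K) with (n := n) (q := q) as (x & Hx & <-).
- intros r Kr. destruct (fsurj r) as [x <-]. now exists x.
- exact Hq.
- apply Hn in Hx. red in Hx. subst x. now apply hom1.
Qed.

Lemma nsub_of_preim (K : gset Q) : subgroup K -> nsub (fun x => K (f x)) -> nsub K.
Proof.
intros sK nK. apply nsub_intro; [exact sK|]. intros q g Kq.
destruct (fsurj q) as [x <-], (fsurj g) as [y <-].
rewrite <- hom_conj by exact fM. now apply (nsub_conj _ x y nK).
Qed.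

Lemma meta_im : meta_Nil_Hamiltonian G -> meta_Nil_Hamiltonian Q.
Proof.
intros mG K sK nK. apply nsub_of_preim; [exact sK|].
apply mG; [now apply subgroup_preim|now apply not_nilpotent_preim].
Qed.

Lemma noetherian_im : noetherian G -> noetherian Q.
Proof.
intros nG K sK _. destruct (nG (fun x => K (f x))) as (l & Hl & gen_l).
{ now apply subgroup_preim. } { now intros x _. }
exists (map f l). split.
- intros y Hy. apply in_map_iff in Hy. destruct Hy as (x & <- & Hx). now apply Hl.
- intros L sL HL q Kq. destruct (fsurj q) as [x <-].
  apply (gen_l (fun x => L (f x))); [now apply subgroup_preim| |exact Kq].
  intros y Hy. apply HL. now apply in_map.
Qed.

Lemma finmod_im (A N : gset G) (A' N' : gset Q) :
  (forall q, A' q -> exists x, A x /\ f x = q) -> (forall x, N x -> N' (f x)) ->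
  finmod A N -> finmod A' N'.
Proof.
intros HA HN [l Hl]. exists (map f l). intros q Aq.
destruct (HA q Aq) as (x & Ax & <-). destruct (Hl x Ax) as (r & Hr & Nx).
exists (f r). split; [now apply in_map|]. rewrite <- homV, <- fM by exact fM. auto.
Qed.

Lemma finmod_preim (A : gset G) (A' N' : gset Q) :
  (forall x, A x -> A' (f x)) -> finmod A' N' -> finmod A (fun x => N' (f x)).
Proof.
intros HA [l Hl].
assert (lift : exists l', forall q, In q l -> exists x, In x l' /\ f x = q).
{ clear Hl. induction l as [|q l [l' Hl']].
  - exists []. now intros q [].
  - destruct (fsurj q) as [x <-]. exists (x :: l'). intros r [<-|Hr].
    + exists x. split; [now left|reflexivity].
    + destruct (Hl' r Hr) as (y & Hy & <-). exists y. split; [now right|reflexivity]. }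
destruct lift as [l' Hl']. exists l'. intros x Ax.
destruct (Hl (f x) (HA x Ax)) as (q & Hq & Nx). destruct (Hl' q Hq) as (r & Hr & <-).
exists r. split; [exact Hr|]. now rewrite fM, homV.
Qed.

Lemma sf_im (N : gset G) :
  solvable_by_finite_series N ->
  solvable_by_finite_series (fun q => exists x, N x /\ f x = q).
Proof.
induction 1 as [N nN tN|N N' nN sN' IH ab|N N' nN sN' IH fin].
- apply sf_trivial; [now apply nsub_im|]. intros _ (x & Nx & <-).
  apply tN in Nx. red in Nx. subst x. now apply hom1.
- apply (sf_abelian _ (fun q => exists x, N' x /\ f x = q)); auto; [now apply nsub_im|].
  intros _ _ (x & Nx & <-) (y & Ny & <-). exists (comm x y).
  split; [now apply ab|now apply hom_comm].
- apply (sf_finite _ (fun q => exists x, N' x /\ f x = q)); auto; [now apply nsub_im|].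
  apply (finmod_im N N'); auto. intros x Nx. now exists x.
Qed.

(** The image of [whole] and [whole] itself are distinct predicates; a finite step with the single
    representative 1 connects them. *)
Lemma sf_im_whole :
  solvable_by_finite_series (whole : gset G) -> solvable_by_finite_series (whole : gset Q).
Proof.
intro H. apply (sf_finite _ _ nsub_whole (sf_im whole H)).
exists [gone]. intros q _. exists gone. split; [now left|].
destruct (fsurj q) as [x <-]. exists x. split; [exact I|grp].
Qed.

End Image.

(** * Abelian normal subgroups *)

Definition abelian {G : Grp} (A : gset G) : Prop :=
  forall a b, A a -> A b -> a ** b = b ** a.

Definition torsionfree {G : Grp} (A : gset G) : Prop :=
  forall a n, A a -> (0 < n)%Z -> zpow a n = gone -> a = gone.

(** The elements of [A] with a positive power in <c> form a finitely generated group, so one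
    exponent k sends all of them into <c>. If c^i = d^q and d^k = c^j, then c^(ik) = c^(jq), and ik
    = jq because c has infinite order. *)
Lemma roots_bounded {G : Grp} (A : gset G) (c : G) :
  noetherian G -> subgroup A -> abelian A -> torsionfree A -> A c -> c <> gone ->
  exists k, (0 < k)%Z /\
    forall d i q, A d -> (0 < q)%Z -> zpow c i = zpow d q -> (q | i * k)%Z.
Proof.
intros nG sA abA tfA Ac nc.
set (R := fun d => A d /\ exists m j, (0 < m)%Z /\ zpow d m = zpow c j).
assert (sR : subgroup R).
{ split; [|split].
  - split; [now apply subgroup_one|]. exists 1%Z, 0%Z. split; [lia|].
    now rewrite zpow1g, zpow0.
  - intros x y (Ax & m & j & Hm & Ex) (Ay & n & k & Hn & Ey).
    split; [now apply subgroup_mul|]. exists (m * n)%Z, (j * n + k * m)%Z. split; [lia|].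
    rewrite zpowMg by auto. rewrite zpowM, Ex, (Z.mul_comm m n), (zpowM y), Ey.
    now rewrite <- !zpowM, <- zpowD.
  - intros x (Ax & m & j & Hm & Ex). split; [now apply subgroup_inv|].
    exists m, (- j)%Z. split; [exact Hm|]. now rewrite zpowVg, Ex, zpowN. }
destruct (nG R sR) as (l & Hl & gen_l); [now intros x _|].
assert (expo : exists k, (0 < k)%Z /\ forall y, In y l -> exists j, zpow y k = zpow c j).
{ clear gen_l. induction l as [|y l IH].
  - exists 1%Z. split; [lia|]. now intros y [].
  - destruct IH as (k & Hk & IH); [intros z Hz; apply Hl; now right|].
    destruct (Hl y (or_introl eq_refl)) as (_ & m & j & Hm & Ey).
    exists (m * k)%Z. split; [lia|]. intros z [<-|Hz].
    + exists (j * k)%Z. now rewrite zpowM, Ey, zpowM.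
    + destruct (IH z Hz) as [i Ei]. exists (i * m)%Z.
      now rewrite Z.mul_comm, zpowM, Ei, zpowM. }
destruct expo as (k & Hk & Hkl). exists k. split; [exact Hk|].
intros d i q Ad Hq E.
assert (Hd : A d /\ exists j, zpow d k = zpow c j).
{ apply (gen_l (fun d => A d /\ exists j, zpow d k = zpow c j)).
  - split; [|split].
    + split; [now apply subgroup_one|]. exists 0%Z. now rewrite zpow1g, zpow0.
    + intros x y [Ax [j Ex]] [Ay [j' Ey]]. split; [now apply subgroup_mul|].
      exists (j + j')%Z. rewrite zpowMg by auto. now rewrite Ex, Ey, zpowD.
    + intros x [Ax [j Ex]]. split; [now apply subgroup_inv|].
      exists (- j)%Z. now rewrite zpowVg, Ex, zpowN.
  - intros y Hy. split; [apply (Hl y Hy)|]. now apply Hkl.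
  - split; [exact Ad|]. exists q, i. now split. }
destruct Hd as [_ [j Ej]].
assert (E2 : zpow c (i * k) = zpow c (j * q)).
{ now rewrite (zpowM c i), E, <- zpowM, Z.mul_comm, zpowM, Ej, <- zpowM. }
assert (E3 : zpow c (i * k - j * q) = gone).
{ unfold Z.sub. rewrite zpowD, zpowN, E2. grp. }
exists j. destruct (Z.lt_trichotomy (i * k - j * q) 0) as [lt|[eq|gt]].
- exfalso. apply nc. apply (tfA c (- (i * k - j * q))%Z); [exact Ac|lia|].
  rewrite zpowN, E3. grp.
- lia.
- exfalso. apply nc. now apply (tfA c (i * k - j * q)%Z).
Qed.

Definition torsion_part {G : Grp} (A : gset G) : gset G :=
  fun a => A a /\ exists n, (0 < n)%Z /\ zpow a n = gone.

Lemma nsub_torsion_part {G : Grp} (A : gset G) :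
  nsub A -> abelian A -> nsub (torsion_part A).
Proof.
intros nA abA. pose proof (nsub_subgroup A nA) as sA. apply nsub_intro.
- split; [|split].
  + split; [now apply subgroup_one|]. exists 1%Z. split; [lia|apply zpow1g].
  + intros x y (Ax & m & Hm & Ex) (Ay & n & Hn & Ey).
    split; [now apply subgroup_mul|]. exists (m * n)%Z. split; [lia|].
    rewrite zpowMg by auto. rewrite zpowM, Ex, Z.mul_comm, zpowM, Ey, !zpow1g. grp.
  + intros x (Ax & m & Hm & Ex). split; [now apply subgroup_inv|].
    exists m. split; [exact Hm|]. rewrite zpowVg, Ex. grp.
- intros x g (Ax & m & Hm & Ex). split; [now apply nsub_conj|].
  exists m. split; [exact Hm|]. rewrite <- conj_zpow, Ex. grp.
Qed.

Lemma finite_torsion_part {G : Grp} (A : gset G) :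
  noetherian G -> nsub A -> abelian A -> finite_set (torsion_part A).
Proof.
intros nG nA abA. pose proof (nsub_subgroup A nA) as sA.
pose proof (nsub_subgroup _ (nsub_torsion_part A nA abA)) as sT.
destruct (nG (torsion_part A) sT) as (l & Hl & gen_l); [now intros x _|].
(* A finite subgroup containing the generators is built one generator at a time: if y^n = 1, then
   <y>K is covered by the n cosets y^i K. *)
assert (ex : exists K : gset G, subgroup K /\ subset K A /\ (forall y, In y l -> K y) /\ finite_set K).
{ clear gen_l. induction l as [|y l IH].
  - exists trivial. split; [apply subgroup_trivial|]. split.
    + intros x ->. now apply subgroup_one.
    + split; [now intros y []|]. exists [gone]. intros x ->. now left.
  - destruct IH as (K & sK & KA & lK & fK); [intros z Hz; apply Hl; now right|].
    destruct (Hl y (or_introl eq_refl)) as (Ay & n & Hn & En).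
    assert (Ayz : forall j, A (zpow y j)) by (intro j; now apply subgroup_zpow).
    exists (fun x => exists j u, K u /\ x = zpow y j ** u). split; [|split; [|split]].
    + split; [|split].
      * exists 0%Z, gone. split; [now apply subgroup_one|]. rewrite zpow0. grp.
      * intros a b (i & u & Ku & ->) (j & v & Kv & ->).
        exists (i + j)%Z, (u ** v). split; [now apply subgroup_mul|].
        rewrite zpowD, !mulgA. f_equal. rewrite <- !mulgA. f_equal. auto.
      * intros a (i & u & Ku & ->). exists (- i)%Z, u^-1.
        split; [now apply subgroup_inv|]. rewrite invgM, zpowN.
        apply abA; apply subgroup_inv; auto.
    + intros x (j & u & Ku & ->). apply subgroup_mul; auto.
    + intros z [<-|Hz].
      * exists 1%Z, gone. split; [now apply subgroup_one|]. rewrite zpow1. grp.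
      * exists 0%Z, z. split; [now apply lK|]. rewrite zpow0. grp.
    + apply (finmod_finite _ K fK).
      exists (map (fun i => zpow y (Z.of_nat i)) (seq 0 (Z.to_nat n))).
      intros x (j & u & Ku & ->). exists (zpow y (j mod n)). split.
      * apply in_map_iff. exists (Z.to_nat (j mod n)).
        assert (B := Z.mod_pos_bound j n Hn). rewrite Z2Nat.id by lia.
        split; [reflexivity|]. apply in_seq. lia.
      * assert (E : zpow y j = zpow y (j mod n)).
        { rewrite (Z.div_mod j n) at 1 by lia. rewrite zpowD, zpowM, En, zpow1g. grp. }
        rewrite E. now rewrite mulKg. }
destruct ex as (K & sK & _ & lK & [lf fK]). exists lf. intros x Tx. apply fK.
now apply (gen_l K sK lK).
Qed.

Definition no_finite_normal (G : Grp) : Prop :=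
  forall F : gset G, nsub F -> finite_set F -> subset F trivial.

Lemma torsionfree_abelian_normal {G : Grp} (A : gset G) :
  noetherian G -> no_finite_normal G -> nsub A -> abelian A -> torsionfree A.
Proof.
intros nG nf nA abA a n Aa Hn E.
apply (nf (torsion_part A)).
- now apply nsub_torsion_part.
- now apply finite_torsion_part.
- split; [exact Aa|]. now exists n.
Qed.

(** On [A] the map sending a to [a,x] = a^-1 a^x is a homomorphism, since both factors lie in the
    abelian group [A]. *)
Lemma comm_zpowl {G : Grp} (A : gset G) a x n :
  nsub A -> abelian A -> A a -> comm (zpow a n) x = zpow (comm a x) n.
Proof.
intros nA abA Aa. pose proof (nsub_subgroup A nA) as sA.
replace (comm a x) with (a^-1 ** conj a x) by grp.
rewrite zpowMg, zpowVg, <- conj_zpow; [grp|].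
apply abA; [now apply subgroup_inv|now apply nsub_conj].
Qed.

(** * Iterated commutators and unipotent action *)

Fixpoint engel {G : Grp} (a x : G) (k : nat) : G :=
  match k with O => a | S k => comm (engel a x k) x end.

Lemma engel_in {G : Grp} (A : gset G) a x k : nsub A -> A a -> A (engel a x k).
Proof. intros nA Aa. induction k; simpl; auto. now apply nsub_comml. Qed.

Lemma engel_zpow {G : Grp} (A : gset G) a x n k :
  nsub A -> abelian A -> A a -> engel (zpow a n) x k = zpow (engel a x k) n.
Proof.
intros nA abA Aa. induction k as [|k IH]; simpl; auto.
rewrite IH. apply (comm_zpowl A); auto. now apply engel_in.
Qed.

(* If x acted non-nilpotently on A, all the subgroups <x>A^n would be normal;
   then [a,x,x] would be an n-th power in A for every n > 0, hence trivial. *)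
Lemma acts_unipotently {G : Grp} (A : gset G) a x :
  noetherian G -> meta_Nil_Hamiltonian G -> nsub A -> abelian A -> torsionfree A ->
  A a -> exists k, engel a x k = gone.
Proof.
intros nG mG nA abA tfA Aa. pose proof (nsub_subgroup A nA) as sA.
apply NNPP. intro no.
set (H := fun (n : Z) (y : G) => exists i b, A b /\ y = zpow x i ** zpow b n).
assert (sH : forall n, subgroup (H n)).
{ intro n. split; [|split].
  - exists 0%Z, gone. split; [now apply subgroup_one|]. rewrite zpow0, zpow1g. grp.
  - intros y z (i & b & Ab & ->) (j & c & Ac & ->).
    assert (Ab' : A (conj b (zpow x j))) by now apply nsub_conj.
    exists (i + j)%Z, (conj b (zpow x j) ** c). split; [now apply subgroup_mul|].
    rewrite zpowMg by auto. rewrite <- conj_zpow, zpowD. grp.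
  - intros y (i & b & Ab & ->).
    exists (- i)%Z, (conj b^-1 (zpow x (- i))). split.
    + apply nsub_conj; auto. now apply subgroup_inv.
    + rewrite <- conj_zpow, zpowVg, zpowN. grp. }
(* The subgroup <x>A^n contains x and a^n. Were it nilpotent, some [a^n,x,...,x] = [a,x,...,x]^n
   would vanish, and torsion-freeness would remove the exponent n. *)
assert (nH : forall n, (0 < n)%Z -> nsub (H n)).
{ intros n Hn. apply mG; [apply sH|]. intros [_ [k Hk]]. apply no. exists k.
  apply (tfA _ n); [now apply engel_in|exact Hn|].
  rewrite <- (engel_zpow A) by auto. apply Hk.
  assert (Hx : H n x).
  { exists 1%Z, gone. split; [now apply subgroup_one|]. rewrite zpow1, zpow1g. grp. }
  assert (Ha : H n (zpow a n)).
  { exists 0%Z, a. split; [exact Aa|]. rewrite zpow0. grp. }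
  clear - Hx Ha. induction k as [|k IH]; simpl; [exact Ha|]. now apply commg_in. }
set (f := comm (comm x a) x).
assert (Af : A f) by (apply nsub_comml, nsub_commr; auto).
(* As <x>A^n is normal and contains x, it contains [x,a] = x^i d^n. The factor x^i commutes with x,
   so [x,a,x] = [d^n,x] = [d,x]^n. *)
assert (pow : forall n, (0 < n)%Z -> exists d, A d /\ f = zpow d n).
{ intros n Hn. assert (Hc : H n (comm x a)).
  { apply nsub_comml; [now apply nH|].
    exists 1%Z, gone. split; [now apply subgroup_one|]. rewrite zpow1, zpow1g. grp. }
  destruct Hc as (i & d & Ad & E). exists (comm d x).
  split; [now apply nsub_comml|]. rewrite <- (comm_zpowl A) by auto.
  unfold f. rewrite E. unfold comm at 1. rewrite invgM.
  assert (C : zpow x i ** x = x ** zpow x i) by (apply zpow_commute; reflexivity).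
  replace (_ ** _) with ((zpow d n)^-1 ** ((zpow x i)^-1 ** x^-1 ** zpow x i ** (zpow d n ** x))) by grp.
  replace ((zpow x i)^-1 ** x^-1 ** zpow x i) with x^-1; [grp|].
  apply (mulg_injl x). rewrite mulgV.
  replace (x ** _) with (x ** (zpow x i)^-1 ** x^-1 ** zpow x i) by grp.
  apply (mulg_injl (zpow x i)). symmetry.
  replace (_ ** (x ** _ ** _ ** _)) with ((zpow x i ** x) ** (zpow x i)^-1 ** x^-1 ** zpow x i) by grp.
  rewrite C. grp. }
assert (f1 : f = gone).
{ apply NNPP. intro nf.
  destruct (roots_bounded A f nG sA abA tfA Af nf) as (k & Hk & Hdiv).
  (* Being a (k+1)-st power would force k + 1 to divide k. *)
  destruct (pow (k + 1)%Z) as (d & Ad & Ed); [lia|].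
  assert (D := Hdiv d 1%Z (k + 1)%Z Ad ltac:(lia)). rewrite zpow1 in D.
  apply Z.divide_pos_le in D; [lia|lia|exact Ed]. }
(* x commutes with [x,a], hence with its inverse [a,x]. *)
apply no. exists 2%nat. simpl. apply comm_eq1.
replace (comm a x) with (comm x a)^-1 by grp.
apply comm_eq1 in f1. apply (mulg_injl (comm x a)). rewrite mulVKg, gmulA, f1, mulgA, mulgV, mulg1. reflexivity.
Qed.

(** * Transfer into a central subgroup *)

Definition bigprod {G : Grp} (f : G -> G) (l : list G) : G :=
  fold_right (fun r acc => f r ** acc) gone l.

Section Transfer.
Variables (G : Grp) (K C : gset G).
Hypotheses (sK : subgroup K) (sC : subgroup C) (CK : subset C K)
  (Ccen : subset C (centr K)) (fin : finmod K C).

Lemma bigprod_in f l : (forall r, In r l -> C (f r)) -> C (bigprod f l).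
Proof.
induction l as [|r l IH]; intro H; simpl; [now apply subgroup_one|].
apply subgroup_mul; [exact sC|apply H; now left|]. apply IH. intros s Hs. apply H. now right.
Qed.

Lemma bigprod_mul f g l :
  (forall r, In r l -> C (f r)) -> (forall r, In r l -> C (g r)) ->
  bigprod (fun r => f r ** g r) l = bigprod f l ** bigprod g l.
Proof.
induction l as [|r l IH]; intros Hf Hg; simpl; [grp|].
rewrite IH by (intros s Hs; first [apply Hf|apply Hg]; now right).
rewrite !mulgA. f_equal. rewrite <- !mulgA. f_equal.
apply Ccen; [apply Hg; now left|]. apply CK, bigprod_in.
intros s Hs. apply Hf. now right.
Qed.

Lemma bigprod_perm f l l' :
  Permutation l l' -> (forall r, In r l -> C (f r)) -> bigprod f l = bigprod f l'.
Proof.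
induction 1 as [|x l l' P IH|x y l|l1 l2 l3 P1 IH1 P2 IH2]; intro H; simpl; auto.
- rewrite IH; auto. intros r Hr. apply H. now right.
- rewrite <- !mulgA. f_equal. apply Ccen; [apply H; now left|].
  apply CK, H. right. now left.
- rewrite IH1 by exact H. apply IH2. intros r Hr. apply H.
  now apply (Permutation_in _ (Permutation_sym P1)).
Qed.

Lemma bigprod_ext (f g : G -> G) l : (forall r, In r l -> f r = g r) -> bigprod f l = bigprod g l.
Proof.
induction l as [|r l IH]; intro H; simpl; [reflexivity|].
rewrite H by now left. f_equal. apply IH. intros s Hs. apply H. now right.
Qed.

Lemma bigprod_map (f h : G -> G) l : bigprod f (map h l) = bigprod (fun r => f (h r)) l.
Proof. induction l; simpl; congruence. Qed.

(** [epsilon] is applied to the coset as a predicate, so by extensionality the choice depends on the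
    coset alone. *)
Let s (x : G) : G := epsilon (inhabits gone) (fun y => C (x^-1 ** y)).

Let s_spec x : C (x^-1 ** s x).
Proof.
apply (epsilon_spec (inhabits gone) (fun y => C (x^-1 ** y))).
exists x. rewrite gmulV. now apply subgroup_one.
Qed.

Let s_eq x y : C (x^-1 ** y) -> s x = s y.
Proof.
intro Cxy. unfold s. f_equal. apply functional_extensionality. intro z.
apply propositional_extensionality. split; intro H.
- replace (y^-1 ** z) with ((x^-1 ** y)^-1 ** (x^-1 ** z)) by grp.
  apply subgroup_mul; auto. now apply subgroup_inv.
- replace (x^-1 ** z) with (x^-1 ** y ** (y^-1 ** z)) by grp.
  now apply subgroup_mul.
Qed.

Let s_eqV x y : s x = s y -> C (x^-1 ** y).
Proof.
intro E. replace (x^-1 ** y) with (x^-1 ** s x ** (y^-1 ** s x)^-1) by grp.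
apply subgroup_mul; auto. apply subgroup_inv; auto. rewrite E. apply s_spec.
Qed.

Let s_in x : K x -> K (s x).
Proof.
intro Kx. rewrite <- (mulVKg x (s x)). apply subgroup_mul; auto.
Qed.

(** V(x) is the product over a transversal of the factors s(xr)^-1 x r. They lie in the central
    subgroup [C], so their order does not matter. For c in [C] every factor equals c, and m is the
    index of [C] in [K]. *)
Lemma transfer_exists :
  exists (V : G -> G) (m : Z), (0 < m)%Z /\ (forall x, C (V x)) /\
    (forall x y, K x -> K y -> V (x ** y) = V x ** V y) /\
    (forall c, C c -> V c = zpow c m).
Proof.
destruct (finmod_index K C sC fin) as (l & Hl & Hc).
(* Listed representatives may share a coset; removing duplicates after applying [s] leaves exactly
   one per coset. *)
set (t := nodup (fun x y : G => excluded_middle_informative (x = y)) (map s l)).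
assert (tK : forall r, In r t -> K r /\ s r = r).
{ intros r Hr. apply nodup_In, in_map_iff in Hr. destruct Hr as (x & <- & Hx). split.
  - apply s_in. now apply Hl.
  - symmetry. apply s_eq, s_spec. }
assert (st : forall x, K x -> In (s x) t).
{ intros x Kx. apply nodup_In. destruct (Hc x Kx) as (r & Hr & Cr).
  rewrite <- (s_eq r x Cr). now apply in_map. }
assert (ndt : NoDup t) by apply NoDup_nodup.
set (phi := fun x r => (s (x ** r))^-1 ** (x ** r)).
assert (phiC : forall x r, C (phi x r)).
{ intros x r. unfold phi. replace (_ ** _) with (((x ** r)^-1 ** s (x ** r))^-1) by grp.
  apply subgroup_inv; auto. }
exists (fun x => bigprod (phi x) t), (Z.of_nat (length t)). split; [|split; [|split]].
- assert (In (s gone) t) by (apply st; now apply subgroup_one).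
  destruct t; [easy|simpl; lia].
- intro x. now apply bigprod_in.
- intros x y Kx Ky. set (h := fun r => s (y ** r)).
  (* Left multiplication by y permutes the cosets, so the product for x may be reindexed along
     [h]. *)
  assert (P : Permutation (map h t) t).
  { apply NoDup_Permutation_bis.
    - apply FinFun.Injective_map_NoDup_in; [|exact ndt].
      intros r r' Hr Hr' E. rewrite <- (proj2 (tK r Hr)), <- (proj2 (tK r' Hr')).
      apply s_eq. apply s_eqV in E. gsimp_in E. exact E.
    - now rewrite length_map.
    - intros z Hz. apply in_map_iff in Hz. destruct Hz as (r & <- & Hr).
      apply st. apply subgroup_mul; auto. apply (tK r Hr). }
  rewrite <- (bigprod_perm (phi x) _ _ P) by auto. rewrite bigprod_map.
  rewrite <- bigprod_mul by auto. apply bigprod_ext. intros r Hr.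
  unfold phi, h. replace (s (x ** s (y ** r))) with (s (x ** y ** r)); [grp|].
  apply s_eq. replace (_ ** _) with ((y ** r)^-1 ** s (y ** r)) by grp. apply s_spec.
- intros c Cc. rewrite (bigprod_ext _ (fun _ => c)).
  + clear. induction t as [|r t IH]; [symmetry; apply zpow0|].
    cbn [bigprod fold_right length]. fold (bigprod (fun _ : G => c) t). rewrite IH.
    replace (Z.of_nat (S (length t))) with (Z.of_nat (length t) + 1)%Z by lia.
    now rewrite zpowSl.
  + intros r Hr. destruct (tK r Hr) as [Kr sr].
    assert (E : c ** r = r ** c) by now apply Ccen.
    unfold phi. replace (s (c ** r)) with r; [rewrite E; grp|].
    rewrite <- sr at 1. apply s_eq. rewrite E. now rewrite mulKg.
Qed.

End Transfer.

(** Let C be the intersection of K = G' with the center. The transfer is trivial on [K,K], and on C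
    it is the m-th power, injective since the center is torsion-free. So [K,K] meets C trivially, is
    finite, hence trivial, and K is torsion-free abelian. If a^n is central, then [a,g]^n = [a^n,g]
    = 1 gives [a,g] = 1. *)
Lemma derived_central {G : Grp} :
  noetherian G -> no_finite_normal G -> finmod (derived : gset G) center ->
  subset (derived : gset G) center.
Proof.
intros nG nf fin. set (K := derived : gset G).
assert (nK : nsub K) by apply nsub_derived.
pose proof (nsub_subgroup K nK) as sK.
assert (nZ : nsub (center : gset G)) by apply nsub_center.
pose proof (nsub_subgroup _ nZ) as sZ.
set (C := fun x => K x /\ center x).
assert (sC : subgroup C) by now apply subgroup_inter.
assert (finC : finmod K C).
{ destruct (finmod_index K center sZ fin) as (l & Hl & Hc). exists l. intros x Kx.
  destruct (Hc x Kx) as (r & Hr & Zr). exists r. split; [exact Hr|]. split; [|exact Zr].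
  apply subgroup_mul; auto. apply subgroup_inv; auto. }
assert (tfZ : torsionfree (center : gset G)).
{ apply torsionfree_abelian_normal; auto. intros a b Za _. now apply Za. }
destruct (transfer_exists G K C) as (V & m & Hm & VinC & VM & VC); auto.
{ now intros x []. }
{ intros x [_ Zx] y _. now apply Zx. }
assert (V1 : V gone = gone).
{ apply (mulg_injl (V gone)). rewrite <- VM by now apply subgroup_one. grp. }
assert (VV : forall x, K x -> V x^-1 = (V x)^-1).
{ intros x Kx. apply invg_uniq. rewrite <- VM; auto; [now rewrite mulgV|].
  now apply subgroup_inv. }
assert (abV : forall x y, K x -> K y -> V x ** V y = V y ** V x).
{ intros x y _ _. now apply (proj2 (VinC x)). }
assert (KK : subset (commg K K) (fun x => K x /\ V x = gone)).
{ apply commg_sub.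
  - split; [|split].
    + split; [now apply subgroup_one|exact V1].
    + intros x y [Kx Ex] [Ky Ey]. split; [now apply subgroup_mul|].
      rewrite VM, Ex, Ey by auto. grp.
    + intros x [Kx Ex]. split; [now apply subgroup_inv|]. rewrite VV, Ex by auto. grp.
  - intros a b Ka Kb. split; [now apply subgroup_comm|]. unfold comm.
    assert (Ka' : K a^-1) by now apply subgroup_inv.
    assert (Kb' : K b^-1) by now apply subgroup_inv.
    assert (Kab : K (a ** b)) by now apply subgroup_mul.
    assert (Kbab : K (b^-1 ** (a ** b))) by now apply subgroup_mul.
    rewrite !VM, !VV by assumption.
    rewrite (abV a b) by auto. grp. }
assert (abK : abelian K).
{ intros a b Ka Kb. apply comm_eq1. apply (nf (commg K K)).
  - now apply nsub_commg.
  - apply (finmod_inj_finite _ C sC).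
    + intros x y Hx Hy Cxy. apply KK in Hx, Hy. destruct Hx as [Kx Ex], Hy as [Ky Ey].
      apply eqg_Vmul. apply (tfZ _ m); [apply Cxy|exact Hm|].
      rewrite <- VC by exact Cxy. rewrite VM, VV, Ex, Ey; auto; [grp|].
      now apply subgroup_inv.
    + destruct finC as [l Hl]. exists l. intros x Hx. apply Hl. now apply KK.
  - now apply commg_in. }
assert (tfK : torsionfree K) by now apply torsionfree_abelian_normal.
intros a Ka g _. apply comm_eq1.
destruct (finmod_zpow K C a sK sC finC Ka) as (n & Hn & _ & Zn).
apply (tfK _ n); [now apply nsub_comml|exact Hn|].
rewrite <- (comm_zpowl K) by auto. apply comm_eq1. now apply Zn.
Qed.

(** * Groups of nilpotency class two *)

Section ClassTwo.
Variable G : Grp.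
Hypothesis cen : subset (derived : gset G) center.

Lemma comm_center (x y : G) : center (comm x y).
Proof. apply cen. now apply commg_in. Qed.

Lemma commMl (x x' y : G) : comm (x ** x') y = comm x y ** comm x' y.
Proof.
replace (comm (x ** x') y) with (conj (comm x y) x' ** comm x' y) by grp.
rewrite conj_eq; [reflexivity|]. now apply comm_center.
Qed.

Lemma comm_zpow (x y : G) n : comm (zpow x n) y = zpow (comm x y) n.
Proof. apply (hom_zpow (fun x => comm x y)). intros a b. apply commMl. Qed.

(** The collection formula with exponent n(n-1)/2 on [b,a]; the equation for 2t avoids a
    division. *)
Lemma zpowMg_class2 (a b : G) (n : nat) :
  exists t, (2 * t = Z.of_nat n * (Z.of_nat n - 1))%Z /\
    zpow (a ** b) (Z.of_nat n) =
    zpow a (Z.of_nat n) ** zpow b (Z.of_nat n) ** zpow (comm b a) t.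
Proof.
induction n as [|n (t & Ht & E)].
- exists 0%Z. split; [reflexivity|]. rewrite !zpow0. grp.
- exists (t + Z.of_nat n)%Z. split; [lia|].
  replace (Z.of_nat (S n)) with (Z.of_nat n + 1)%Z by lia.
  set (m := Z.of_nat n) in *. rewrite zpowD, E, zpow1.
  rewrite (zpowD a), (zpowD b), !zpow1, zpowD.
  assert (Zc : forall j x, zpow (comm b a) j ** x = x ** zpow (comm b a) j).
  { intros j x. apply zpow_commute. now apply comm_center. }
  assert (Eb : zpow b m ** a = a ** zpow b m ** zpow (comm b a) m).
  { rewrite <- comm_zpow. grp. }
  rewrite !mulgA. f_equal. rewrite (Zc t (a ** b)). rewrite <- !mulgA, Eb.
  rewrite !mulgA. do 2 f_equal. rewrite <- !mulgA. rewrite (Zc m b).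
  rewrite !mulgA. f_equal. rewrite <- !zpowD. f_equal. lia.
Qed.

(** For n = 2r + 1 the exponent n(n-1)/2 is nr, so the central correction is itself an n-th power
    and can be absorbed into h. Odd powers are thus closed under products. *)
Lemma odd_powers_mul (a b : G) (r : Z) : (0 <= r)%Z ->
  exists h, zpow a (2 * r + 1) ** zpow b (2 * r + 1) = zpow h (2 * r + 1).
Proof.
intro Hr. destruct (zpowMg_class2 a b (Z.to_nat (2 * r + 1))) as (t & Ht & E).
rewrite Z2Nat.id in Ht, E by lia. exists (a ** b ** zpow (comm b a) (- r)).
assert (Et : t = ((2 * r + 1) * r)%Z) by nia.
rewrite zpowMg, E, <- (zpowM _ (- r)), mulgA, <- zpowD.
- replace (t + - r * (2 * r + 1))%Z with 0%Z by lia. rewrite zpow0. grp.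
- symmetry. apply zpow_commute. now apply comm_center.
Qed.

End ClassTwo.

(** * Finiteness of the derived subgroup *)

(** For normal [K], this is nilpotency of G/K without forming the quotient. *)
Definition nilmod {G : Grp} (K : gset G) : Prop := exists n, subset (lcs whole n) K.

(** Take z in the last term of the lower central series that is not contained in [K]. *)
Lemma central_modulo {G : Grp} (K : gset G) :
  nilmod K -> ~ subset whole K -> exists z, ~ K z /\ forall g, K (comm z g).
Proof.
intros [n Hn] nK. induction n as [|n IH]; [easy|].
destruct (classic (subset (lcs whole n) K)) as [H|H]; [now apply IH|].
apply not_all_ex_not in H. destruct H as [z Hz]. apply imply_to_and in Hz.
destruct Hz as [Lz nz]. exists z. split; [exact nz|].
intro g. apply Hn. now apply commg_in.
Qed.

Lemma nilpotent_of_nilmod_center {G : Grp} :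
  nilmod (center : gset G) -> nilpotent (whole : gset G).
Proof.
intros [n Hn]. split; [apply subgroup_whole|]. exists (S n).
apply commg_sub; [apply subgroup_trivial|]. intros a b Ha _.
apply comm_eq1. now apply Hn.
Qed.

Lemma finmod_mono {G : Grp} (A K K' : gset G) : subset K K' -> finmod A K -> finmod A K'.
Proof.
intros KK' [l Hl]. exists l. intros x Ax. destruct (Hl x Ax) as (r & Hr & Kx).
exists r. auto.
Qed.

Lemma finmod_trivial {G : Grp} (A K : gset G) : subgroup K -> finite_set A -> finmod A K.
Proof.
intros sK [l Hl]. exists l. intros x Ax. exists x. split; [now apply Hl|].
rewrite gmulV. now apply subgroup_one.
Qed.

Lemma uniform_exponent {G : Grp} (M : gset G) :
  nsub M -> finmod whole M -> exists e, (0 < e)%Z /\ forall g, M (zpow g e).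
Proof.
intros nM fM. pose proof (nsub_subgroup M nM) as sM.
pose proof fM as [l Hl].
assert (ex : forall l : list G, exists e, (0 < e)%Z /\ forall r, In r l -> M (zpow r e)).
{ clear l Hl. induction l as [|r l (e & He & Hl)].
  - exists 1%Z. split; [lia|now intros r []].
  - destruct (finmod_zpow whole M r subgroup_whole sM fM I) as (m & Hm & Mr).
    exists (m * e)%Z. split; [lia|]. intros s [<-|Hs].
    + rewrite zpowM. now apply subgroup_zpow.
    + rewrite Z.mul_comm, zpowM. apply subgroup_zpow; auto. }
destruct (ex l) as (e & He & Hle). exists e. split; [exact He|]. intro g.
(* [zpow_mod_normal] expects the factor from M on the left, so r^-1 g in M is turned into g r^-1 in
   M. *)
destruct (Hl g I) as (r & Hr & Mg). apply nsub_swap in Mg; [|exact nM].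
destruct (zpow_mod_normal M whole (g ** r^-1) r nM Mg I e) as (t & Mt & E).
replace (g ** r^-1 ** r) with g in E by grp. rewrite E.
apply subgroup_mul; auto.
Qed.

(* A subgroup containing F and supplementing the centraliser of F is not
   nilpotent; the q-th powers generate such a supplement when q = 1 modulo the
   exponent of G / C_G(F). *)
Lemma derived_finite_of_nilpotent_mod_finite {G : Grp} (F : gset G) :
  noetherian G -> meta_Nil_Hamiltonian G -> ~ nilpotent (whole : gset G) ->
  nsub F -> finite_set F -> nilmod F -> finite_set (derived : gset G).
Proof.
intros nG mG nnil nF fF [c0 Hc0]. apply NNPP. intro inf.
(* The quotient E = G/N has an infinite derived subgroup, which becomes finite modulo any nontrivial
   normal subgroup of E. *)
destruct (maximal_subgroup (fun N : gset G => nsub N /\ subset F N /\ ~ finmod derived N) F nG)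
  as (N & (nN & FN & infN) & _ & maxN).
{ intros H [nH _]. now apply nsub_subgroup. }
{ split; [exact nF|]. split; [now intros x|]. intro H. apply inf.
  now apply (finmod_finite _ F). }
destruct (quotient_exists G N nN) as (E & f & fM & fsurj & fker).
assert (nE : noetherian E) by now apply (noetherian_im G E f).
assert (minE : forall K : gset E, nsub K -> ~ subset K trivial -> finmod derived K).
{ intros K nK ntK. apply NNPP. intro infK. apply ntK. intros q Kq.
  destruct (fsurj q) as [x <-]. apply fker.
  apply (maxN (fun x => K (f x))); [|intros y Ny|exact Kq].
  - split; [now apply nsub_preim|]. split.
    + intros y Fy. apply FN, fker in Fy. rewrite Fy. now apply subgroup_one, nsub_subgroup.
    + intro H. apply infK. revert H. apply (finmod_im _ _ f fM); auto.
      now apply derived_lift.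
  - apply fker in Ny. rewrite Ny. now apply subgroup_one, nsub_subgroup. }
assert (infE : ~ finite_set (derived : gset E)).
{ intro H. apply infN.
  apply (finmod_mono _ (fun x => trivial (f x))); [intros x Hx; now apply fker|].
  apply (finmod_preim _ _ f fM fsurj _ derived).
  - now apply derived_hom.
  - apply finmod_trivial; [apply subgroup_trivial|exact H]. }
assert (nfE : no_finite_normal E).
{ intros K nK fK. apply NNPP. intro ntK. apply infE.
  apply (finmod_finite _ K fK). now apply minE. }
assert (ntder : ~ subset (derived : gset E) trivial).
{ intro H. apply infE. exists [gone]. intros x Hx. left. symmetry. now apply H. }
(* E is a nontrivial nilpotent group, because N contains [F]. *)
assert (ntcen : ~ subset (center : gset E) trivial).
{ destruct (central_modulo (trivial : gset E)) as (z & nz & Hz).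
  - exists c0. intros q Hq.
    destruct (lcs_lift _ _ f fM whole whole (whole_lift _ _ f fsurj) c0 q Hq) as (x & Hx & <-).
    now apply fker, FN, Hc0.
  - intro H. apply ntder. intros x _. now apply H.
  - intro H. apply nz, H. intros g _. now apply comm_eq1, Hz. }
assert (cen : subset (derived : gset E) center).
{ apply derived_central; auto. apply minE; auto. apply nsub_center. }
assert (sZ : subgroup (center : gset E)) by apply nsub_subgroup, nsub_center.
assert (abZ : abelian (center : gset E)) by (intros a b Za _; now apply Za).
assert (tfZ : torsionfree (center : gset E))
  by (apply torsionfree_abelian_normal; auto; apply nsub_center).
assert (ex : exists x y : E, comm x y <> gone).
{ apply NNPP. intro no. apply ntder. apply commg_sub; [apply subgroup_trivial|].
  intros a b _ _. apply NNPP. intro nab. apply no. now exists a, b. }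
destruct ex as (x & y & nc). set (c := comm x y) in *.
assert (Zc : center c) by now apply comm_center.
destruct (roots_bounded center c nE sZ abZ tfZ Zc nc) as (k & Hk & roots).
set (M := centr F). assert (nM : nsub M) by now apply nsub_centr.
destruct (uniform_exponent M nM) as (e & He & expM).
{ destruct (centr_finite_index F whole nF fF subgroup_whole) as (l & _ & Hl).
  exists l. intros g Hg. destruct (Hl g Hg) as (r & Hr & _ & Mg). now exists r. }
(* Since q is 1 modulo e, g^q acts on [F] as g does. Since q is 1 modulo k, it is prime to k and
   exceeds it. The factor 2 makes q odd, so that [odd_powers_mul] applies. *)
set (q := (2 * (e * k) + 1)%Z).
assert (Hq : (0 < q)%Z) by lia.
set (L := fun u : E => exists h i, u = zpow h q ** zpow x i).
assert (sL : subgroup L).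
{ split; [|split].
  - exists gone, 0%Z. rewrite zpow1g, zpow0. grp.
  - intros u v (h & i & ->) (h' & i' & ->).
    destruct (odd_powers_mul E cen h (conj h' (zpow x i)^-1) (e * k)) as [h'' Eh]; [lia|].
    fold q in Eh. exists h'', (i + i')%Z. rewrite <- Eh, <- conj_zpow, zpowD. grp.
  - intros u (h & i & ->). exists (conj h^-1 (zpow x i)), (- i)%Z.
    rewrite <- conj_zpow, zpowVg, zpowN. grp. }
assert (nL : nsub L).
{ apply (nsub_of_preim _ _ f fM fsurj); [exact sL|].
  apply mG; [now apply subgroup_preim|]. intros [_ [n Hn]]. apply nnil.
  split; [apply subgroup_whole|]. exists (n + c0)%nat.
  (* The first c0 commutators lead into [F]. From there on, g may be replaced by g^q, which lies in
     the preimage of L, so nilpotency of that preimage would make G nilpotent. *)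
  assert (low : forall n, subset (lcs whole (n + c0)) (fun d => F d /\ lcs (fun g => L (f g)) n d)).
  { clear n Hn. induction n as [|n IH].
    - intros d Hd. apply Hc0 in Hd. split; [exact Hd|]. simpl.
      apply FN, fker in Hd. rewrite Hd. now apply subgroup_one.
    - simpl. apply commg_sub.
      + apply subgroup_inter; [now apply nsub_subgroup|apply subgroup_commg].
      + intros d g Hd _. apply IH in Hd. destruct Hd as [Fd Ld].
        split; [now apply nsub_comml|].
        assert (Eg : comm d g = comm d (zpow g q)).
        { assert (Eq : zpow g q = g ** zpow (zpow g e) (2 * k)).
          { unfold q. replace (2 * (e * k) + 1)%Z with (1 + e * (2 * k))%Z by lia.
            now rewrite zpowD, zpow1, zpowM. }
          assert (Mm : M (zpow (zpow g e) (2 * k)))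
            by (apply subgroup_zpow; [now apply nsub_subgroup|apply expM]).
          replace (comm d g) with (d^-1 ** conj d g) by grp.
          replace (comm d (zpow g q)) with (d^-1 ** conj d (zpow g q)) by grp.
          rewrite Eq, <- conj_comp. f_equal. symmetry. apply conj_eq. symmetry.
          apply Mm. now apply nsub_conj. }
        rewrite Eg. apply commg_in; [exact Ld|]. rewrite hom_zpow by exact fM.
        exists (f g), 0%Z. rewrite zpow0. grp. }
  intros d Hd. apply Hn. now apply low. }
assert (Lc : L c).
{ apply nsub_comml; [exact nL|]. exists gone, 1%Z. rewrite zpow1g, zpow1. grp. }
destruct Lc as (h & i & Ec).
assert (qi : (q | i)%Z).
(* Centrality of c = h^q x^i gives 1 = [c,y] = [h,y]^q c^i, so c^i is the q-th power of a central
   element. *)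
{ assert (D : (q | i * k)%Z).
  { apply (roots (comm h y)^-1); [|exact Hq|].
    - apply subgroup_inv; [exact sZ|]. now apply comm_center.
    - assert (Ecy : comm c y = gone) by now apply comm_eq1, Zc.
      rewrite Ec, (commMl E cen), !(comm_zpow E cen) in Ecy.
      rewrite zpowVg. apply invg_uniq. exact Ecy. }
  replace i with (i * q - 2 * e * (i * k))%Z by (unfold q; lia).
  apply Z.divide_sub_r; [now exists i|]. now apply Z.divide_mul_r. }
destruct qi as [j ->].
(* With q dividing i, both factors of c are q-th powers, hence so is c = u^q. As [u,v]^q = [c,v] = 1
   in the torsion-free center, u is central; then q divides k although q > k. *)
assert (pw : exists u, c = zpow u q).
{ destruct (odd_powers_mul E cen h (zpow x j) (e * k)) as [u Eu]; [lia|].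
  fold q in Eu. exists u. now rewrite Ec, <- Eu, zpowM. }
destruct pw as [u Eu].
assert (Zu : center u).
{ intros v _. apply comm_eq1. apply (tfZ _ q); [now apply comm_center|exact Hq|].
  rewrite <- (comm_zpow E cen), <- Eu. now apply comm_eq1, Zc. }
assert (D := roots u 1%Z q Zu Hq). rewrite zpow1 in D. apply D in Eu.
apply Z.divide_pos_le in Eu; [|lia]. unfold q in Eu. nia.
Qed.

(** * Centralizers of torsion-free abelian normal subgroups *)

Lemma engel_last {G : Grp} (a x : G) k :
  a <> gone -> engel a x k = gone ->
  exists j, engel a x j <> gone /\ comm (engel a x j) x = gone.
Proof.
intros na. induction k as [|k IH]; simpl; intro H; [easy|].
destruct (classic (engel a x k = gone)) as [E|nE]; [now apply IH|]. now exists k.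
Qed.

Lemma engel_comm {G : Grp} (a x : G) k : engel (comm a x) x k = comm (engel a x k) x.
Proof. induction k as [|k IH]; simpl; congruence. Qed.

(** If g in G' acted nontrivially on [A], unipotency would give d in [A] with c = [d,g] nontrivial
    and fixed by g, so that conjugation by g^n sends d to d c^n. But some positive power g^m lies in
    [A] and fixes d, which gives c^m = 1. *)
Lemma derived_centralises {G : Grp} (A : gset G) :
  noetherian G -> meta_Nil_Hamiltonian G -> nsub A -> abelian A -> torsionfree A ->
  finmod derived A -> subset derived (centr A).
Proof.
intros nG mG nA abA tfA fin g Hg b Ab. symmetry. apply comm_eq1. apply NNPP. intro nc.
destruct (acts_unipotently A (comm b g) g nG mG nA abA tfA) as [k Hk].
{ now apply nsub_comml. }
destruct (engel_last _ _ k nc Hk) as (j & nj & Hj). rewrite engel_comm in nj, Hj.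
set (d := engel b g j) in *. set (c := comm d g) in *. apply comm_eq1 in Hj.
assert (Ad : A d) by now apply engel_in.
destruct (finmod_zpow derived A g) as (m & Hm & Am); auto.
{ apply nsub_subgroup, nsub_derived. } { now apply nsub_subgroup. }
assert (E : forall n, conj d (zpow g n) = d ** zpow c n).
{ assert (step : forall n, conj d (zpow g (n + 1)) = conj d (zpow g n) ** c).
  { intro n. rewrite zpowSl, <- conj_comp, (conj_comm d g). fold c.
    rewrite conjM. f_equal. apply conj_eq. symmetry. apply zpow_commute. now symmetry. }
  apply Z_ind_both.
  - rewrite !zpow0. grp.
  - intros n IH. rewrite step, IH, zpowD, zpow1. grp.
  - intros n IH. rewrite step, zpowD, zpow1, gmulA in IH.
    apply (f_equal (fun u => u ** c^-1)) in IH. rewrite !mulgA, mulgV, !mulg1 in IH.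
    exact IH. }
apply nj. apply (tfA c m); [now apply nsub_comml|exact Hm|].
apply (mulg_injl d). rewrite <- E, mulg1. apply conj_eq. now apply abA.
Qed.

(** Among nontrivial normal subgroups B of G inside [A], take one with largest centralizer C. If C
    is G, then B is central. Otherwise choose z outside C but central modulo C: the centralizer of z
    in B is normal in G, and nontrivial because z acts unipotently, and its own centralizer contains
    both C and z. *)
Lemma center_nontrivial {G : Grp} (A : gset G) :
  noetherian G -> meta_Nil_Hamiltonian G -> nsub A -> abelian A -> torsionfree A ->
  ~ subset A trivial -> nilmod (centr A) -> ~ subset (center : gset G) trivial.
Proof.
intros nG mG nA abA tfA ntA [n Hn].
destruct (maximal_subgroup (fun C : gset G => exists B : gset G, nsub B /\ subset B A /\
  ~ subset B trivial /\ forall x, C x <-> centr B x) (centr A) nG)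
  as (C & (B & nB & BA & ntB & CB) & AC & maxC).
{ intros H (B & nB & _ & _ & E). pose proof (subgroup_centr B) as sB. split; [|split].
  - apply E. now apply subgroup_one.
  - intros x y Hx Hy. apply E. apply subgroup_mul; auto; now apply E.
  - intros x Hx. apply E. apply subgroup_inv; auto; now apply E. }
{ exists A. split; [exact nA|]. split; [now intros x|]. now split. }
intro tcen.
destruct (central_modulo C) as (z & nz & Hz).
{ exists n. intros x Hx. now apply AC, Hn. }
{ intro H. apply ntB. intros b Bb. apply tcen. intros g _.
  symmetry. now apply (proj1 (CB g) (H g I)). }
apply nz.
apply (maxC (centr (fun b => B b /\ b ** z = z ** b))).
- exists (fun b => B b /\ b ** z = z ** b).
  pose proof (nsub_subgroup B nB) as sB. split; [|split; [|split]]; [| | |easy].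
  + apply nsub_intro.
    * split; [|split].
      -- split; [now apply subgroup_one|grp].
      -- intros a b [Ba Ea] [Bb Eb]. split; [now apply subgroup_mul|].
         now rewrite mulgA, Eb, <- mulgA, Ea, mulgA.
      -- intros a [Ba Ea]. split; [now apply subgroup_inv|].
         apply (mulg_injl a). rewrite mulVKg, <- mulgA, Ea. grp.
    * intros b g [Bb Eb]. split; [now apply nsub_conj|].
      (* z commutes with b^g iff z^(g^-1) = z [z, g^-1] commutes with b *)
      assert (Ez : conj z g^-1 ** b = b ** conj z g^-1).
      { rewrite conj_comm. assert (Q := proj1 (CB _) (Hz g^-1) b Bb).
        now rewrite mulgA, Q, <- mulgA, <- Eb, mulgA. }
      apply (f_equal (fun u => conj u g)) in Ez. rewrite !conjM, conj_comp in Ez.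
      replace (conj z (g^-1 ** g)) with z in Ez by grp. now symmetry.
  + intros b [Bb _]. now apply BA.
  + intro tB. apply ntB. intros b Bb. apply NNPP. intro nb.
    destruct (acts_unipotently A b z nG mG nA abA tfA (BA b Bb)) as [k Hk].
    destruct (engel_last _ _ k nb Hk) as (j & nj & Hj). apply nj, tB.
    split; [now apply engel_in|]. now apply comm_eq1.
- intros x Cx b [Bb _]. now apply (proj1 (CB x) Cx).
- intros b [_ Eb]. now symmetry.
Qed.

Lemma derived_finite_minimal {G : Grp} :
  noetherian G -> meta_Nil_Hamiltonian G -> solvable_by_finite_series (whole : gset G) ->
  ~ nilpotent (whole : gset G) ->
  (forall K : gset G, nsub K -> ~ subset K trivial -> nilmod K \/ finmod derived K) ->
  finite_set (derived : gset G).
Proof.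
intros nG mG sG nnil minG. apply NNPP. intro inf.
destruct (classic (exists F : gset G, nsub F /\ finite_set F /\ ~ subset F trivial))
  as [(F & nF & fF & ntF)|no].
{ apply inf. destruct (minG F nF ntF) as [H|H].
  - now apply (derived_finite_of_nilpotent_mod_finite F).
  - now apply (finmod_finite _ F). }
assert (nf : no_finite_normal G).
{ intros F nF fF. apply NNPP. intro ntF. apply no. now exists F. }
destruct (sf_minimal_normal whole sG) as (A & nA & ntA & [abA|fA]).
{ intro H. apply nnil. split; [apply subgroup_whole|]. now exists 0%nat. }
2: { now apply ntA, nf. }
assert (tfA : torsionfree A) by now apply torsionfree_abelian_normal.
assert (ntZ : ~ subset (center : gset G) trivial).
{ destruct (minG A nA ntA) as [[n Hn]|fin].
  - apply (center_nontrivial A); auto. exists n. intros x Hx a Aa.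
    apply abA; auto.
  (* Here G/A need not be nilpotent, so A is replaced by its intersection with G', which G' will be
     shown to centralize. *)
  - set (B := fun x => derived x /\ A x).
    assert (nB : nsub B) by (apply nsub_inter; [apply nsub_derived|exact nA]).
    assert (abB : abelian B) by (intros a b [_ Aa] [_ Ab]; now apply abA).
    assert (tfB : torsionfree B) by now apply torsionfree_abelian_normal.
    assert (sD : subgroup (derived : gset G)) by apply nsub_subgroup, nsub_derived.
    apply (center_nontrivial B); auto.
    (* If G' met A trivially, its elements would lie in distinct cosets of A, of which only finitely
       many occur. *)
    + intro tB. apply inf. apply (finmod_inj_finite _ A); [now apply nsub_subgroup| |exact fin].
      intros x y Dx Dy Axy. apply eqg_Vmul. apply tB. split; [|exact Axy].
      apply subgroup_mul; auto. now apply subgroup_inv.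
    + exists 1%nat. apply derived_centralises; auto.
      destruct (finmod_index derived A (nsub_subgroup A nA) fin) as (l & Hl & Hc).
      exists l. intros x Dx. destruct (Hc x Dx) as (r & Hr & Ar). exists r.
      split; [exact Hr|]. split; [|exact Ar].
      apply subgroup_mul; auto. apply subgroup_inv; auto. }
apply nnil, nilpotent_of_nilmod_center.
destruct (minG center nsub_center ntZ) as [H|H]; [exact H|].
exists 1%nat. now apply derived_central.
Qed.

Lemma derived_finite {G : Grp} :
  noetherian G -> meta_Nil_Hamiltonian G -> solvable_by_finite_series (whole : gset G) ->
  ~ nilpotent (whole : gset G) -> finite_set (derived : gset G).
Proof.
intros nG mG sG nnil. apply NNPP. intro inf.
destruct (maximal_subgroup (fun N : gset G => nsub N /\ ~ nilmod N /\ ~ finmod derived N)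
  trivial nG) as (N & (nN & nnilN & infN) & _ & maxN).
{ intros H [nH _]. now apply nsub_subgroup. }
{ split; [apply nsub_trivial|]. split.
  - intro H. apply nnil. now split; [apply subgroup_whole|].
  - intro H. apply inf. apply (finmod_finite _ trivial); [|exact H].
    exists [gone]. intros x ->. now left. }
destruct (quotient_exists G N nN) as (Q & f & fM & fsurj & fker).
apply infN. apply (finmod_mono _ (fun x => trivial (f x))); [intros x Hx; now apply fker|].
apply (finmod_preim _ _ f fM fsurj _ derived); [now apply derived_hom|].
apply finmod_trivial; [apply subgroup_trivial|]. apply derived_finite_minimal.
- now apply (noetherian_im _ _ f).
- now apply (meta_im _ _ f).
- now apply (sf_im_whole _ _ f).
- intros [_ [n Hn]]. apply nnilN. exists n. intros x Hx. apply fker, Hn.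
  now apply (lcs_hom _ _ f fM whole).
- intros K nK ntK. apply NNPP. intro H. apply not_or_and in H. destruct H as [nnilK infK].
  apply ntK. intros q Kq. destruct (fsurj q) as [x <-]. apply fker.
  apply (maxN (fun x => K (f x))); [|intros y Ny|exact Kq].
  + split; [now apply nsub_preim|]. split.
    * intros [n Hn]. apply nnilK. exists n. intros q Hq.
      destruct (lcs_lift _ _ f fM whole whole (whole_lift _ _ f fsurj) n q Hq) as (y & Hy & <-).
      now apply Hn.
    * intro H. apply infK. revert H. apply (finmod_im _ _ f fM); auto.
      now apply derived_lift.
  + apply fker in Ny. rewrite Ny. now apply subgroup_one, nsub_subgroup.
Qed.

(** * Consequences of a finite derived subgroup *)

Lemma nsub_above_derived {G : Grp} (H : gset G) :
  subgroup H -> subset derived H -> nsub H.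
Proof.
intros sH DH. apply nsub_intro; [exact sH|]. intros x g Hx. rewrite conj_comm.
apply subgroup_mul; auto. apply DH. now apply commg_in.
Qed.

Lemma in_firstn_S {T : Type} (d : T) (l : list T) i y :
  (i < length l)%nat -> In y (firstn (S i) l) <-> In y (firstn i l) \/ y = nth i l d.
Proof.
revert i. induction l as [|x l IH]; intros i Hi; [simpl in Hi; lia|].
destruct i as [|i].
- simpl. intuition.
- change (firstn (S (S i)) (x :: l)) with (x :: firstn (S i) l).
  change (firstn (S i) (x :: l)) with (x :: firstn i l).
  simpl in Hi. cbn [In nth]. rewrite IH by lia. tauto.
Qed.

(** Generators of G are adjoined to G' one at a time; every intermediate subgroup contains G' and is
    therefore normal. *)
Lemma polycyclic_abelianization {G : Grp} :
  noetherian G -> polycyclic_over (derived : gset G) whole.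
Proof.
intro nG. destruct (nG whole subgroup_whole) as (l & _ & gen_l); [now intros x|].
set (S := fun i => gen (fun y => derived y \/ In y (firstn i l))).
assert (DS : forall i, subset derived (S i)) by (intros i x Dx; apply gen_in; now left).
assert (sS : forall i, subgroup (S i)) by (intro i; apply subgroup_gen).
exists (length l), S. split; [|split].
- intro x. split; [|apply DS]. intro H. apply H.
  + apply nsub_subgroup, nsub_derived.
  + intros y [Dy|[]]. exact Dy.
- intro x. split; [easy|]. intros _. apply (gen_l (S (length l)) (sS _)); [|exact I].
  intros y Hy. apply gen_in. right. now rewrite firstn_all.
- intros i Hi.
  assert (SS : subset (S i) (S (Datatypes.S i))).
  { intros x Hx. apply Hx; [apply sS|]. intros y [Dy|Hy].
    - now apply DS.
    - apply gen_in. right. apply (in_firstn_S gone); auto. }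
  split.
  + split; [apply sS|]. split; [apply sS|]. split; [exact SS|].
    intros g x _ Hx. now apply (nsub_conj (S i) x g (nsub_above_derived _ (sS i) (DS i))).
  + exists (nth i l gone). intro x. split; intro H.
    * apply H; [apply subgroup_gen|]. intros y [Dy|Hy].
      -- apply gen_in. left. now apply DS.
      -- apply (in_firstn_S gone) in Hy; [|exact Hi]. apply gen_in.
         destruct Hy as [Hy| ->]; [left|now right]. apply gen_in. now right.
    * apply H; [apply sS|]. intros y [Hy| ->]; [now apply SS|].
      apply gen_in. right. apply (in_firstn_S gone); auto.
Qed.

(** Let M be the intersection of [H] with the centralizer of G'. Then [M,M] lies in G', which M
    centralizes, so M has class at most two; its index in [H] is finite because G' is. *)
Lemma nilpotent_by_finite_of_finite_derived {G : Grp} (H : gset G) :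
  finite_set (derived : gset G) -> subgroup H -> nilpotent_by_finite G H.
Proof.
intros fD sH. set (C := centr (derived : gset G)).
assert (nC : nsub C) by apply nsub_centr, nsub_derived.
assert (sM : subgroup (fun x => H x /\ C x))
  by (apply subgroup_inter; [exact sH|now apply nsub_subgroup]).
exists (fun x => H x /\ C x). split; [|split].
- split; [exact sM|]. split; [exact sH|]. split; [now intros x []|].
  intros k h Hk [Hh Ch]. split; [|now apply (nsub_conj C)].
  apply subgroup_mul; auto; [now apply subgroup_inv|now apply subgroup_mul].
- split; [exact sM|]. exists 2%nat.
  apply commg_sub; [apply subgroup_trivial|]. intros a b Ha [_ Cb].
  apply comm_eq1. symmetry. apply Cb. revert a Ha.
  apply commg_sub; [apply nsub_subgroup, nsub_derived|]. intros a b' _ _.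
  now apply commg_in.
- apply centr_finite_index; [apply nsub_derived|exact fD|exact sH].
Qed.

Lemma derived_finite_consequences (G : Grp) :
  noetherian G -> finite_set (derived : gset G) ->
  finite_by_polycyclic G /\ nilpotent_by_finite G (Fit G).
Proof.
intros nG fD. split.
- exists derived. split; [apply nsub_derived|]. split; [exact fD|].
  now apply polycyclic_abelianization.
- apply nilpotent_by_finite_of_finite_derived; [exact fD|apply subgroup_gen].
Qed.

End FiniteDerivedSubgroup.

Theorem mainTheorem6 (G : Grp) :
  ~ nilpotent G (whole G) ->
  meta_Nil_Hamiltonian G ->
  polycyclic_by_finite G ->
  finite_set G (derived G) /\ finite_by_polycyclic G /\
  nilpotent_by_finite G (Fit G).
Proof.
intros nnil mG pG.
pose proof (noetherian_polycyclic_by_finite G pG) as nG.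
assert (fD : finite_set G (derived G)).
{ apply derived_finite; [exact nG|exact mG| |exact nnil].
  now apply sf_polycyclic_by_finite. }
split; [exact fD|]. now apply derived_finite_consequences.
Qed.
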